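(* Let $G$ be an Eulerian graph with maximum degree $\Delta(G)=4$. Then $G$ admits a path odd-cover of size at most $3$ and a cycle odd-cover of size at most $3$.
   Context: Graphs are finite, simple and undirected, assumed to have no isolated vertices. A graph is called Eulerian if every vertex has even degree (connectedness is not required). The symmetric difference $H_1\oplus\cdots\oplus H_k$ of graphs is the graph whose edges are those belonging to an odd number of the edge sets $E(H_1),\dots,E(H_k)$; graphs are identified with their edge sets. A path odd-cover (resp. cycle odd-cover) of $G$ is a collection $\mathcal{H}=\{H_1,\dots,H_k\}$ of paths (resp. cycles, of length at least $3$) that are subgraphs of the complete graph on the vertex set $V(G)$ (they may use edges not in $G$), such that $G=H_1\oplus\cdots\oplus H_k$. Its size is $k$. *)

(* Defs.v *)
From mathcomp Require Import all_boot.

Set Implicit Arguments.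
Unset Strict Implicit.
Unset Printing Implicit Defensive.

(* A graph on the vertex set V (a finType) is identified with its edge set, a
   set of 2-element subsets of V. *)
Notation graph V := {set {set V}}.

Definition simple (V : finType) (G : graph V) : Prop :=
  forall e, e \in G -> #|e| = 2.

Definition deg (V : finType) (G : graph V) (v : V) : nat :=
  #|[set e in G | v \in e]|.

Definition no_isolated (V : finType) (G : graph V) : Prop :=
  forall v, 0 < deg G v.

Definition maxdeg (V : finType) (G : graph V) : nat := \max_(v : V) deg G v.

Definition eulerian (V : finType) (G : graph V) : Prop :=
  forall v, ~~ odd (deg G v).

Definition symdiff (V : finType) (Hs : {set graph V}) : graph V :=
  [set e | odd #|[set H in Hs | e \in H]|].

Definition path_edges (V : finType) (s : seq V) : graph V :=
  [set e in [seq [set p.1; p.2] | p <- zip s (behead s)]].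

(* [next s x] is the cyclic successor of x in s, so the edge closing the cycle
   is included. *)
Definition cycle_edges (V : finType) (s : seq V) : graph V :=
  [set e in [seq [set x; next s x] | x <- s]].

(* Since graphs have no isolated vertices, a path has at least one edge. *)
Definition is_path (V : finType) (H : graph V) : Prop :=
  exists s : seq V, [/\ 2 <= size s, uniq s & H = path_edges s].

Definition is_cycle (V : finType) (H : graph V) : Prop :=
  exists s : seq V, [/\ 3 <= size s, uniq s & H = cycle_edges s].

(* The paths and cycles below range over the complete graph on V: their edges
   need not belong to G.  Taking a set rather than a multiset of graphs loses
   nothing: two equal members cancel in the symmetric difference. *)
Definition path_odd_cover (V : finType) (G : graph V) (Hs : {set graph V}) :
    Prop :=
  (forall H, H \in Hs -> is_path H) /\ G = symdiff Hs.

Definition cycle_odd_cover (V : finType) (G : graph V) (Hs : {set graph V}) :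
    Prop :=
  (forall H, H \in Hs -> is_cycle H) /\ G = symdiff Hs.

(* Main.v *)
(* A graph with all degrees in {2, 4} is the edge-disjoint union of two families
   A and B of vertex-disjoint cycles: apply twice the fact that two fixpoint-free
   involutions have a common alternating 2-colouring, once to get an Eulerian
   orientation and once to colour the arcs.

   Remove one edge from each cycle.  The paths left over from A are linked into
   one long path P1, those from B into one long path P2, and the third path (or
   cycle) must carry the removed edges together with the links.  Choose the
   removed edges so that they form no cycle; they then form disjoint paths
   x_0 x_1 ... x_n whose edges come alternately from A and B.  Following such a
   path, the links x_1x_2, x_3x_4, ... of P1 and x_2x_3, ... of P2 are themselves
   removed edges, so all but x_0x_1 and x_{n-1}x_n cancel.  Hence each alternating
   path gives a small configuration, and configurations merge like bits: those of
   parity 0 close up to three cycles, and those of parity 1 are three paths with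
   ends p-u, u-q, p-q.  The parity is that of the number of vertices lying on a
   removed edge of both families, and it can be prescribed: on three consecutive
   vertices x, y, z of a cycle of A, where x lies on a removed edge of B and z does
   not, removing xy or yz changes it.

   Three cycles also require that number to be positive, for which one more shared
   vertex, on two other cycles, is needed; if there is none, all shared vertices lie
   on a single cycle C, and the other cycles of A and B form one disjoint family. *)

Require Import Defs.
From mathcomp Require Import all_boot.

Set Implicit Arguments.
Unset Strict Implicit.
Unset Printing Implicit Defensive.

(** * Walks and circuits as parity functions on edges *)

Section Parity.
Variables (V : finType).
Implicit Types (x y : V) (s : seq V) (e : {set V}).

Definition edge e x y : bool := e == [set x; y].

Lemma edgeC e x y : edge e x y = edge e y x.
Proof. by rewrite /edge setUC. Qed.

Lemma edgeP e x y u v : edge e x y -> edge e u v ->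
  (x = u /\ y = v) \/ (x = v /\ y = u).
Proof.
move=> /eqP-> /eqP /setP E.
have := E x; have := E y; have := E u; have := E v.
rewrite !inE !eqxx !orbT /=.
do 4![case: eqP => ?; subst => //=]; try by [left|right].
all: try by rewrite eqxx.
all: by do ![case: eqP => ?; subst => //=]; try by [left|right].
Qed.

(** Traversals are counted modulo 2, so the laws for concatenation and reversal need no uniqueness;
    uniqueness only matters when a walk is compared with an edge set. *)
Fixpoint walk s e : bool :=
  if s is x :: s' then
    (if s' is y :: _ then edge e x y else false) (+) walk s' e
  else false.

Definition circuit s e : bool :=
  if s is x :: s' then walk (rcons s x) e else false.

Lemma walk_cons2 x y s e :
  walk (x :: y :: s) e = edge e x y (+) walk (y :: s) e.
Proof. by []. Qed.

Lemma walk1 x e : walk [:: x] e = false.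
Proof. by []. Qed.

End Parity.

Arguments walk : simpl never.
Arguments circuit : simpl never.

Ltac xor_cases :=
  repeat match goal with
  | |- context [walk ?s ?e] => case: (walk s e)
  | |- context [circuit ?s ?e] => case: (circuit s e)
  | |- context [edge ?e ?x ?y] => case: (edge e x y)
  end.

Section ParityTheory.
Variables (V : finType).
Implicit Types (d x y : V) (s t : seq V) (e : {set V}).

Lemma walk_cat d s t e : s != [::] -> t != [::] ->
  walk (s ++ t) e = walk s e (+) walk t e (+) edge e (last d s) (head d t).
Proof.
elim: s => // x [|y s] IH _ t0.
  by case: t t0 {IH} => //= y t _; rewrite walk_cons2 ?walk1 addbC.
by rewrite !cat_cons !walk_cons2 -cat_cons IH //= !addbA.
Qed.

Lemma walk_rcons d s x e : s != [::] ->
  walk (rcons s x) e = walk s e (+) edge e (last d s) x.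
Proof. by move=> s0; rewrite -cats1 (walk_cat d) //= ?walk1 addbF. Qed.

Lemma head_rev d s : head d (rev s) = last d s.
Proof. by case/lastP: s => // s x; rewrite rev_rcons last_rcons. Qed.

Lemma last_rev d s : last d (rev s) = head d s.
Proof. by rewrite -head_rev revK. Qed.

Lemma rev_nil s : (rev s == [::]) = (s == [::]).
Proof. by rewrite -!size_eq0 size_rev. Qed.

Lemma walk_rev s e : walk (rev s) e = walk s e.
Proof.
elim: s => // x [|y s] IH //.
rewrite rev_cons (walk_rcons x) ?rev_nil // IH last_rev.
by rewrite walk_cons2 addbC edgeC.
Qed.

Lemma circuitE d s e : s != [::] ->
  circuit s e = walk s e (+) edge e (last d s) (head d s).
Proof. by case: s => // x s _; rewrite /circuit (walk_rcons d). Qed.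

Lemma circuit_catC s t e : circuit (s ++ t) e = circuit (t ++ s) e.
Proof.
case: s => [|x s]; first by rewrite cats0.
case: t => [|y t]; first by rewrite cats0.
rewrite !(circuitE x) ?(walk_cat x) // !last_cat /=.
by xor_cases.
Qed.

Lemma circuit_rot n s e : circuit (rot n s) e = circuit s e.
Proof. by rewrite /rot circuit_catC cat_take_drop. Qed.

Lemma circuit_rev s e : circuit (rev s) e = circuit s e.
Proof.
case: s => // x s.
by rewrite !(circuitE x) ?rev_nil // walk_rev last_rev head_rev edgeC.
Qed.

(** * Edge sets of paths and cycles as parity functions *)

Lemma path_edges_cons x y s :
  path_edges (x :: y :: s) = [set x; y] |: path_edges (y :: s).
Proof. by apply/setP => e; rewrite !inE. Qed.

Lemma path_edges_sub s e x : e \in path_edges s -> x \in e -> x \in s.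
Proof.
elim: s => [|y [|z s] IH]; rewrite ?[_ \in path_edges _]inE //.
rewrite inE; case/predU1P => [->|es].
  by rewrite !inE => /orP[]->; rewrite ?orbT.
by move=> xe; rewrite inE IH ?orbT // inE.
Qed.

(** Without repeated vertices no edge is traversed twice, because the first vertex lies on no later
    edge. *)
Lemma mem_path_edges s e : uniq s -> (e \in path_edges s) = walk s e.
Proof.
elim: s => [|x [|y s] IH]; [by rewrite inE|by rewrite inE|move=> xs].
rewrite path_edges_cons in_setU1 IH; last by case/andP: xs.
rewrite walk_cons2 -[e == _]/(edge e x y).
have [|//] := boolP (edge e x y) => /eqP exy /=.
rewrite -IH; last by case/andP: xs.
apply/esym/negP => es.
have: x \in y :: s by apply: path_edges_sub es _; rewrite exy !inE eqxx.
by move: xs; rewrite /= inE => /andP[/negbTE->].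
Qed.

Lemma map_next x s : uniq (x :: s) ->
  [seq (y, next (x :: s) y) | y <- x :: s] = zip (x :: s) (rcons s x).
Proof.
move=> us; have sz : size (x :: s) = size (rcons s x) by rewrite size_rcons.
apply: (@eq_from_nth _ (x, x)) => [|i].
  by rewrite size_map size_zip -sz minnn.
rewrite size_map => lti.
rewrite (nth_map x) // nth_zip // next_nth mem_nth // index_uniq //.
congr (_, _); rewrite nth_rcons.
(* At the last index [next] wraps around to [x], the vertex appended by [rcons]. *)
have [//|ge] := ltnP i (size s).
have -> : i = size s by apply/eqP; rewrite eqn_leq ge -ltnS lti.
by rewrite eqxx nth_default.
Qed.

Lemma cycle_edges_cons x s : uniq (x :: s) ->
  cycle_edges (x :: s) = path_edges (x :: rcons s x).
Proof.
move=> us; rewrite /cycle_edges /path_edges.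
have -> : [seq [set y; next (x :: s) y] | y <- x :: s] =
    [seq [set p.1; p.2] | p <- zip (x :: s) (rcons s x)].
  by rewrite -map_next // -map_comp.
have <- // : zip (x :: rcons s x) (rcons s x) = zip (x :: s) (rcons s x).
have sz : size (x :: s) = size (rcons s x) by rewrite size_rcons.
by rewrite -{2}[rcons s x]cats0 -rcons_cons -cats1 zip_cat // cats0.
Qed.

Lemma path_edges_rcons d s x : s != [::] ->
  path_edges (rcons s x) = [set last d s; x] |: path_edges s.
Proof.
elim: s => [|y [|z s] IH] // _.
  by rewrite [rcons _ _]/= path_edges_cons.
by rewrite 2!rcons_cons path_edges_cons -rcons_cons IH // path_edges_cons setUCA.
Qed.

(** On two vertices the single edge would be traversed twice and cancel; from three on, the closing
    edge differs from all the others. *)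
Lemma mem_cycle_edges s e : uniq s -> 3 <= size s ->
  (e \in cycle_edges s) = circuit s e.
Proof.
case: s => // x [|y [|z s]] // us _.
rewrite cycle_edges_cons // -rcons_cons (path_edges_rcons x) // in_setU1.
rewrite mem_path_edges // (circuitE x) // -[e == _]/(edge e _ _).
have [|] := boolP (edge e _ _); last by rewrite addbF.
rewrite addbT => exy; apply/esym/negP.
rewrite /= in exy.
case/andP: us => xs us w.
move: w; rewrite walk_cons2.
have zl := mem_last z s.
(* The closing edge is not the first edge, since the last vertex is not [y], and not a later one,
   since those avoid [x]. *)
case: (boolP (edge e x y)) => [exy' _|_ /=].
  case: (edgeP exy exy') => -[lx yx]; first by move: xs; rewrite inE -yx eqxx.
  by case/andP: us => /negP[]; rewrite -lx.
rewrite -mem_path_edges // => es.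
have: x \in y :: z :: s.
  by apply: path_edges_sub es _; rewrite (eqP exy) !inE eqxx orbT.
by move: xs => /negP.
Qed.

Lemma circuit_mem s e x : circuit s e -> x \in e -> x \in s.
Proof.
move=> cs; have sz: s != [::] by case: s cs.
have H t : walk t e -> x \in e -> x \in t.
  elim: t => // y [|z t] IH //; rewrite walk_cons2 => w xe.
  have [exy|nexy] := boolP (edge e y z).
    by move: xe; rewrite (eqP exy) !inE => /orP[]->; rewrite ?orbT.
  by move: w; rewrite (negbTE nexy) => /IH/(_ xe); rewrite !inE => ->; rewrite orbT.
case: s cs {sz} => //= y s /H w /w.
by rewrite inE mem_rcons inE orbA orbb.
Qed.

Lemma circuit_last_head d s e : uniq s -> 3 <= size s ->
  edge e (last d s) (head d s) -> circuit s e.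
Proof.
move=> us ss es; rewrite -mem_cycle_edges //.
case: s us ss es => // x s us ss es.
by rewrite cycle_edges_cons // -rcons_cons (path_edges_rcons d) // in_setU1 -/(edge e _ _) es.
Qed.

End ParityTheory.

(** * Configurations and how they merge *)

Section Cells.
Variables (V : finType) (d : V).
Implicit Types (x y : V) (s t l P Q R T S : seq V) (e : {set V}).
Implicit Types (g h : {set V} -> bool).

Definition apart S T := forall x, x \in S -> x \in T -> False.

Lemma uniq_cat_apart S T s t :
  apart S T -> uniq s -> uniq t -> {subset s <= S} -> {subset t <= T} ->
  uniq (s ++ t).
Proof.
move=> ST us ut sS tT; rewrite cat_uniq us ut andbT /=.
by apply/hasPn => x /tT xT; apply/negP => /sS /ST; apply.
Qed.

Lemma apartC S T : apart S T -> apart T S.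
Proof. by move=> ST x xT xS; apply: ST xT. Qed.

Lemma sub_catl s S T : {subset s <= S} -> {subset s <= S ++ T}.
Proof. by move=> sS x /sS; rewrite mem_cat => ->. Qed.

Lemma sub_catr s S T : {subset s <= T} -> {subset s <= S ++ T}.
Proof. by move=> sT x /sT; rewrite mem_cat orbC => ->. Qed.

Lemma sub_cat s t S : {subset s <= S} -> {subset t <= S} ->
  {subset s ++ t <= S}.
Proof. by move=> sS tS x; rewrite mem_cat => /orP[/sS|/tS]. Qed.

Lemma sub_rev s S : {subset s <= S} -> {subset rev s <= S}.
Proof. by move=> sS x; rewrite mem_rev => /sS. Qed.

(* [g] collects the edges of the cycles treated so far; [P1] runs through the
   cycles of the first family, [P2] through those of the second, and the paths
   [R], inside the third path or cycle, carry the removed edges and the links.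
   Here one family is involved, and [P] and [R] have the same ends. *)
Definition cell_single g S T := exists P R,
  [/\ uniq P, uniq R, 3 <= size P & 2 <= size R] /\
  [/\ {subset P <= S}, {subset R <= T}, head d P = head d R,
      last d P = last d R &
      forall e, g e = walk P e (+) walk R e].

(* Joining the two ends of [P1], the two ends of [P2], and [R1] to [R2] by the
   same two edges yields three cycles. *)
Definition cell_even g S1 S2 T := exists P1 P2 R1 R2,
  [/\ uniq P1, uniq P2 & uniq (R1 ++ R2)] /\
  [/\ 3 <= size P1, 3 <= size P2, 2 <= size R1 & 2 <= size R2] /\
  [/\ {subset P1 <= S1}, {subset P2 <= S2} & {subset R1 ++ R2 <= T}] /\
  [/\ head d P1 = head d R1, head d P2 = last d R1,
      last d P1 = head d R2, last d P2 = last d R2 &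
      forall e, g e = walk P1 e (+) walk P2 e (+) walk R1 e (+) walk R2 e].

Definition cell_odd g S1 S2 T := exists P1 P2 R,
  [/\ uniq P1, uniq P2 & uniq R] /\
  [/\ 3 <= size P1, 3 <= size P2 & 2 <= size R] /\
  [/\ {subset P1 <= S1}, {subset P2 <= S2} & {subset R <= T}] /\
  [/\ head d P1 = head d R, last d P1 = head d P2, last d P2 = last d R &
      forall e, g e = walk P1 e (+) walk P2 e (+) walk R e].

Definition cell (b : bool) := if b then cell_odd else cell_even.

Lemma uniq_catC s t : uniq (s ++ t) = uniq (t ++ s).
Proof. by apply: perm_uniq; rewrite perm_catC. Qed.

Lemma cell_swap b g S1 S2 T : cell b g S1 S2 T -> cell b g S2 S1 T.
Proof.
case: b => /=.
  case=> P1 [P2 [R [[u1 u2 u3] [[s1 s2 s3] [[i1 i2 i3] [e1 e2 e3 E]]]]]].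
  exists (rev P2), (rev P1), (rev R); rewrite !rev_uniq !size_rev.
  rewrite !head_rev !last_rev; split; first by split.
  split; first by split.
  split; first by split; apply: sub_rev.
  by split => // e; rewrite E !walk_rev; xor_cases.
case=> P1 [P2 [R1 [R2 [[u1 u2 u3] [[s1 s2 s3 s4] [[i1 i2 i3] [e1 e2 e3 e4 E]]]]]]].
exists P2, P1, (rev R1), (rev R2); rewrite !size_rev !head_rev !last_rev.
split.
  split=> //; rewrite -rev_cat rev_uniq uniq_catC //.
split; first by split.
split; first by split => // x; rewrite mem_cat !mem_rev -mem_cat => /i3.
by split => // e; rewrite E !walk_rev; xor_cases.
Qed.

Lemma cell_ext b g h S1 S2 T : g =1 h -> cell b g S1 S2 T -> cell b h S1 S2 T.
Proof.
move=> gh; case: b => /=.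
  case=> P1 [P2 [R [A [B [C [e1 e2 e3 E]]]]]].
  by exists P1, P2, R; do ![split => //]; move=> e; rewrite -gh E.
case=> P1 [P2 [R1 [R2 [A [B [C [e1 e2 e3 e4 E]]]]]]].
by exists P1, P2, R1, R2; do ![split => //]; move=> e; rewrite -gh E.
Qed.

Lemma cell_sub b g S1 S2 T S1' S2' T' :
  {subset S1 <= S1'} -> {subset S2 <= S2'} -> {subset T <= T'} ->
  cell b g S1 S2 T -> cell b g S1' S2' T'.
Proof.
move=> H1 H2 H3; case: b => /=.
  case=> P1 [P2 [R [A [B [[C1 C2 C3] C]]]]].
  exists P1, P2, R; do 3![split => //]; split.
  - by move=> x /C1/H1.
  - by move=> x /C2/H2.
  - by move=> x /C3/H3.
case=> P1 [P2 [R1 [R2 [A [B [[C1 C2 C3] C]]]]]].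
exists P1, P2, R1, R2; do 3![split => //]; split.
- by move=> x /C1/H1.
- by move=> x /C2/H2.
- by move=> x /C3/H3.
Qed.

Lemma last_cat0 s t : t != [::] -> last d (s ++ t) = last d t.
Proof. by case: t => // x t _; rewrite last_cat. Qed.

Lemma head_cat0 s t : s != [::] -> head d (s ++ t) = head d s.
Proof. by case: s. Qed.

Lemma nonnil n s : n < size s -> s != [::].
Proof. by case: s. Qed.

Lemma cat_nonnil s t : s != [::] -> s ++ t != [::].
Proof. by case: s. Qed.

(** [P] is spliced onto an end of [P1], and [R] onto the third path at the same vertex. Both splices
    create the same junction edge, which cancels. *)
Lemma merge_single b g h S1 S2 T S T' : cell b g S1 S2 T ->
  cell_single h S T' -> apart S1 S -> apart T T' ->
  cell b (fun e => g e (+) h e) (S1 ++ S) S2 (T ++ T').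
Proof.
move=> + [P [R [[uP uR /nonnil sP /nonnil sR] [iP iR eh el E']]]] a1 a3; case: b => /=.
  case=> P1 [P2 [R1 [[u1 u2 u3] [[s1 s2 s3] [[i1 i2 i3] [e1 e2 e3 E]]]]]].
  have [n1 n2 n3] := And3 (nonnil s1) (nonnil s2) (nonnil s3).
  exists (P ++ P1), P2, (R ++ R1).
  rewrite !size_cat !head_cat0 ?last_cat0 //.
  split; first split => //.
  - by rewrite uniq_catC; apply: uniq_cat_apart a1 _ _ _ _.
  - by rewrite uniq_catC; apply: uniq_cat_apart a3 _ _ _ _.
  split; first by split => //; do ?[exact: ltn_addr | apply: ltn_addl].
  split; first by split=> //; apply: sub_cat;
    [apply: sub_catr|apply: sub_catl|apply: sub_catr|apply: sub_catl].
  split => // e; rewrite E E' !(walk_cat d) // el e1 /=.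
  by xor_cases.
case=> P1 [P2 [R1 [R2 [[u1 u2 u3] [[s1 s2 s3 s4] [[i1 i2 i3] [e1 e2 e3 e4 E]]]]]]].
have [n1 n2 n3 n4] := And4 (nonnil s1) (nonnil s2) (nonnil s3) (nonnil s4).
exists (P1 ++ P), P2, R1, (rev R ++ R2).
rewrite !size_cat !size_rev !head_cat0 ?last_cat0 ?rev_nil // head_rev.
split; first split => //.
- by apply: uniq_cat_apart a1 _ _ _ _.
- rewrite -(perm_uniq (s1 := (R1 ++ R2) ++ R)).
    by apply: uniq_cat_apart a3 _ _ _ _.
  by rewrite -catA perm_cat2l perm_catC perm_cat2r perm_sym perm_rev.
split; first by split => //; do ?[exact: ltn_addr | apply: ltn_addl].
split; first split=> //.
- by apply: sub_cat; [apply: sub_catl|apply: sub_catr].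
- move=> x; rewrite !mem_cat mem_rev.
  have := i3 x; rewrite mem_cat; have := iR x.
  by case: (x \in R) => [->//|_]; rewrite ?orbT //=; move=> H /H ->.
split => // e; rewrite E E' !(walk_cat d) ?rev_nil // last_rev walk_rev eh e3 /=.
by rewrite (edgeC _ (head d R2)); xor_cases.
Qed.

(* Two even cells must be joined with the second [Q2] reversed, for otherwise the
   two joining edges close up part of the third cycle. *)
Lemma merge_cell b c g h S1 S2 T S1' S2' T' : cell b g S1 S2 T ->
  cell c h S1' S2' T' -> apart S1 S1' -> apart S2 S2' -> apart T T' ->
  cell (b (+) c) (fun e => g e (+) h e) (S1 ++ S1') (S2 ++ S2') (T ++ T').
Proof.
have even_odd g' h' A1 A2 A A1' A2' A' : cell_even g' A1 A2 A ->
  cell_odd h' A1' A2' A' -> apart A1 A1' -> apart A2 A2' -> apart A A' ->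
  cell_odd (fun e => g' e (+) h' e) (A1 ++ A1') (A2 ++ A2') (A ++ A').
  case=> P1 [P2 [R1 [R2 [[u1 u2 u3] [[s1 s2 s3 s4] [[i1 i2 i3] [e1 e2 e3 e4 E]]]]]]].
  case=> Q1 [Q2 [T0 [[v1 v2 v3] [[t1 t2 t3] [[j1 j2 j3] [f1 f2 f3 F]]]]]].
  have [n1 n2 n3 n4] := And4 (nonnil s1) (nonnil s2) (nonnil s3) (nonnil s4).
  have [m1 m2 m3] := And3 (nonnil t1) (nonnil t2) (nonnil t3).
  (* The two edges that insert [rev T0] between [R1] and [R2] are the junctions of [Q2] with [P2]
     and of [P1] with [Q1]. *)
  move=> a1 a2 a3; exists (P1 ++ Q1), (Q2 ++ P2), (R1 ++ rev T0 ++ R2).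
  rewrite !size_cat !head_cat0 ?last_cat0 ?cat_nonnil ?rev_nil //.
  split; first split => //.
  - by apply: uniq_cat_apart a1 _ _ _ _.
  - by rewrite uniq_catC; apply: uniq_cat_apart a2 _ _ _ _.
  - rewrite -(perm_uniq (s1 := (R1 ++ R2) ++ T0)).
      by apply: uniq_cat_apart a3 _ _ _ _.
    by rewrite -catA perm_cat2l perm_catC perm_cat2r perm_sym perm_rev.
  split; first by split => //; do ?[exact: ltn_addr | apply: ltn_addl].
  split; first split=> //.
  - by apply: sub_cat; [apply: sub_catl|apply: sub_catr].
  - by apply: sub_cat; [apply: sub_catr|apply: sub_catl].
  - move=> x; rewrite !mem_cat mem_rev.
    have := i3 x; rewrite mem_cat; have := j3 x.
    by case: (x \in T0) => [->//|_]; rewrite ?orbT //=; move=> H /H ->.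
  split => // e; rewrite E F !(walk_cat d) ?cat_nonnil ?rev_nil //.
  rewrite head_cat0 ?rev_nil // walk_rev head_rev last_rev.
  rewrite -f1 -f3 -e3 -e2 (edgeC _ (last d Q2)) (edgeC _ (head d Q1)).
  by xor_cases.
case: b; case: c => /= HP HQ a1 a2 a3.
- case: HP => P1 [P2 [R [[u1 u2 u3] [[s1 s2 s3] [[i1 i2 i3] [e1 e2 e3 E]]]]]].
  case: HQ => Q1 [Q2 [R' [[v1 v2 v3] [[t1 t2 t3] [[j1 j2 j3] [f1 f2 f3 F]]]]]].
  have [n1 n2 n3] := And3 (nonnil s1) (nonnil s2) (nonnil s3).
  have [m1 m2 m3] := And3 (nonnil t1) (nonnil t2) (nonnil t3).
  (* Both junctions join the vertex shared by [P1] and [P2] to the one shared by [Q1] and [Q2]. They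
     cancel, and [R], [R'] stay separate. *)
  exists (P1 ++ rev Q1), (rev P2 ++ Q2), R, R'.
  rewrite !size_cat !size_rev !head_cat0 ?last_cat0 ?rev_nil // ?head_rev ?last_rev.
  split; first split => //.
  + by apply: uniq_cat_apart a1 _ _ _ _; rewrite ?rev_uniq //; apply: sub_rev.
  + by apply: uniq_cat_apart a2 _ _ _ _; rewrite ?rev_uniq //; apply: sub_rev.
  + by apply: uniq_cat_apart a3 _ _ _ _.
  split; first by split => //; do ?[exact: ltn_addr | apply: ltn_addl].
  split; first split=> //.
  + by apply: sub_cat; [apply: sub_catl|apply: sub_catr; apply: sub_rev].
  + by apply: sub_cat; [apply: sub_catl; apply: sub_rev|apply: sub_catr].
  + by apply: sub_cat; [apply: sub_catl|apply: sub_catr].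
  split => // e; rewrite E F !(walk_cat d) ?rev_nil // !walk_rev head_rev last_rev.
  by rewrite e2 f2; xor_cases.
- apply: cell_ext (_ : cell true _ _ _ _) => [e|]; first exact: addbC.
  apply: (@cell_sub true _ (S1' ++ S1) (S2' ++ S2) (T' ++ T)).
  1-3: by move=> x; rewrite !mem_cat orbC.
  by apply: even_odd => //; apply: apartC.
- exact: even_odd.
case: HP => P1 [P2 [R1 [R2 [[u1 u2 u3] [[s1 s2 s3 s4] [[i1 i2 i3] [e1 e2 e3 e4 E]]]]]]].
case: HQ => Q1 [Q2 [T1 [T2 [[v1 v2 v3] [[t1 t2 t3 t4] [[j1 j2 j3] [f1 f2 f3 f4 F]]]]]]].
have [n1 n2 n3 n4] := And4 (nonnil s1) (nonnil s2) (nonnil s3) (nonnil s4).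
have [m1 m2 m3 m4] := And4 (nonnil t1) (nonnil t2) (nonnil t3) (nonnil t4).
(* The junctions at [rev R2] are the edge from [last P2] to [last Q2] and the edge from [last P1] to
   [head Q1]. *)
exists (P1 ++ Q1), (P2 ++ rev Q2), R1, (T2 ++ rev R2 ++ T1).
rewrite !size_cat !size_rev !head_cat0 ?last_cat0 ?cat_nonnil ?rev_nil // ?head_rev ?last_rev.
split; first split => //.
- by apply: uniq_cat_apart a1 _ _ _ _.
- by apply: uniq_cat_apart a2 _ _ _ _; rewrite ?rev_uniq //; apply: sub_rev.
- rewrite -(perm_uniq (s1 := (R1 ++ R2) ++ (T1 ++ T2))).
    by apply: uniq_cat_apart a3 _ _ _ _.
  apply/permP => p; rewrite !count_cat count_rev -!addnA.
  by congr (_ + _); rewrite [RHS]addnC addnA.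
split; first by split => //; do ?[exact: ltn_addr | apply: ltn_addl].
split; first split=> //.
- by apply: sub_cat; [apply: sub_catl|apply: sub_catr].
- by apply: sub_cat; [apply: sub_catl|apply: sub_catr; apply: sub_rev].
- move=> x; rewrite !mem_cat mem_rev => xR; apply/orP.
  have [xT|xT] := boolP (x \in T1 ++ T2); first by right; apply: j3.
  left; apply: i3; move: xR xT; rewrite !mem_cat.
  by do 4![case: (_ \in _)].
split => // e; rewrite E F !(walk_cat d) ?cat_nonnil ?rev_nil //.
rewrite head_cat0 ?rev_nil // !walk_rev !head_rev !last_rev.
rewrite -f1 -f4 -e3 -e4 (edgeC _ (last d Q2)).
by xor_cases.
Qed.

(** * From cells to odd covers *)

Lemma symdiff_setU1 (H : graph V) (Hs : {set graph V}) e : H \notin Hs ->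
  (e \in symdiff (H |: Hs)) = (e \in H) (+) (e \in symdiff Hs).
Proof.
move=> HnHs; rewrite !inE.
have [eH|neH] := boolP (e \in H).
  rewrite (_ : [set K in H |: Hs | e \in K] = H |: [set K in Hs | e \in K]).
    by rewrite cardsU1 inE (negbTE HnHs).
  by apply/setP => K; rewrite !inE; case: eqP => [->|].
congr odd; apply: eq_card => K; rewrite !inE.
by case: eqP => [->|] //=; rewrite (negbTE neH) andbF.
Qed.

(* Inserting a graph that is already present removes it, so a repetition in
   the list only makes the set smaller. *)
Lemma symdiff_seq (P : graph V -> Prop) (L : seq (graph V)) :
  (forall H, H \in L -> P H) ->
  exists Hs : {set graph V}, [/\ forall H, H \in Hs -> P H,
    forall e, (e \in symdiff Hs) = \big[addb/false]_(H <- L) (e \in H) &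
    #|Hs| <= size L].
Proof.
elim: L => [|H L IH] PL.
  exists set0; split=> [H|e|]; rewrite ?cards0 // ?inE // big_nil.
  by rewrite (_ : [set _ in _ | _] = set0) ?cards0 //; apply/setP => H; rewrite !inE.
have [K KL|Hs [PHs E sz]] := IH; first by apply: PL; rewrite inE KL orbT.
have [HHs|HHs] := boolP (H \in Hs).
  exists (Hs :\ H); split=> [K|e|].
  - by rewrite !inE => /andP[_ /PHs].
  - have := symdiff_setU1 (H := H) (Hs := Hs :\ H) e.
    rewrite !inE eqxx setD1K // => /(_ isT) F.
    by rewrite big_cons -E inE F addbA addbb.
  - by apply: leq_trans (leqW sz); rewrite subset_leq_card // subD1set.
exists (H |: Hs); split=> [K|e|].
- by case/setU1P => [->|/PHs//]; apply: PL; rewrite inE eqxx.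
- by rewrite symdiff_setU1 // big_cons E.
- by rewrite cardsU1 HHs.
Qed.

Lemma cell_odd_cover (G : graph V) S1 S2 T :
  cell_odd (fun e => e \in G) S1 S2 T ->
  exists Hs : {set graph V}, path_odd_cover G Hs /\ #|Hs| <= 3.
Proof.
case=> P1 [P2 [R [[u1 u2 u3] [[s1 s2 s3] [_ [_ _ _ E]]]]]].
have [|Hs [HsP HsE sz]] :=
  @symdiff_seq (@is_path V) [:: path_edges P1; path_edges P2; path_edges R].
  move=> H; rewrite !inE => /or3P[] /eqP->;
    [exists P1|exists P2|exists R]; split=> //; exact: ltnW.
exists Hs; split=> //; split=> //; apply/setP => e.
by rewrite HsE !big_cons big_nil E !mem_path_edges // addbF addbA.
Qed.

Lemma cell_even_cover (G : graph V) S1 S2 T :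
  cell_even (fun e => e \in G) S1 S2 T ->
  exists Hs : {set graph V}, cycle_odd_cover G Hs /\ #|Hs| <= 3.
Proof.
case=> P1 [P2 [R1 [R2 [[u1 u2 u3] [[s1 s2 s3 s4] [_ [e1 e2 e3 e4 E]]]]]]].
have [n1 n2 n3 n4] := And4 (nonnil s1) (nonnil s2) (nonnil s3) (nonnil s4).
have u4 : uniq (R1 ++ rev R2).
  by rewrite -(perm_uniq (s1 := R1 ++ R2)) // perm_cat2l perm_sym perm_rev.
have s5 : 3 <= size (R1 ++ rev R2).
  by rewrite size_cat size_rev (leq_trans _ (leq_add s3 s4)).
have [|Hs [HsP HsE sz]] := @symdiff_seq (@is_cycle V)
    [:: cycle_edges P1; cycle_edges P2; cycle_edges (R1 ++ rev R2)].
  by move=> H; rewrite !inE => /or3P[] /eqP->;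
    [exists P1|exists P2|exists (R1 ++ rev R2)].
exists Hs; split=> //; split=> //; apply/setP => e.
rewrite HsE !big_cons big_nil E !mem_cycle_edges // !(circuitE d) ?cat_nonnil //.
rewrite (walk_cat d) ?rev_nil // walk_rev head_cat0 // last_cat0 ?rev_nil //.
rewrite head_rev last_rev e1 e2 e3 e4 (edgeC _ (last d R2)).
by xor_cases.
Qed.

(** [P] and [R] have the same ends, so one and the same edge closes both into cycles. If [R] is a
    single edge, it closes [P] itself and two cycles suffice. *)
Lemma circuit_single_cover (G : graph V) g a S T :
  uniq a -> 3 <= size a -> cell_single g S T ->
  (forall e, (e \in G) = circuit a e (+) g e) ->
  exists Hs : {set graph V}, cycle_odd_cover G Hs /\ #|Hs| <= 3.
Proof.
move=> ua sa [P [R [[u1 u2 s1 s2] [_ _ e1 e2 E]]]] GE.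
have [n1 n2] := (nonnil s1, nonnil s2).
have [s3|] := ltnP 2 (size R).
  have [|Hs [HsP HsE sz]] := @symdiff_seq (@is_cycle V)
      [:: cycle_edges a; cycle_edges P; cycle_edges R].
    by move=> H; rewrite !inE => /or3P[] /eqP->; [exists a|exists P|exists R].
  exists Hs; split=> //; split=> //; apply/setP => e.
  rewrite HsE !big_cons big_nil GE E !mem_cycle_edges //.
  rewrite (circuitE d e n1) (circuitE d e n2) e1 e2.
  by xor_cases.
case: R s2 e1 e2 E {u2 n2} => [|x [|y []]] //= _ e1 e2 E _.
have [|Hs [HsP HsE sz]] := @symdiff_seq (@is_cycle V)
    [:: cycle_edges a; cycle_edges P].
  by move=> H; rewrite !inE => /orP[] /eqP->; [exists a|exists P].
exists Hs; split; last exact: leqW.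
split=> //; apply/setP => e.
rewrite HsE !big_cons big_nil GE E !mem_cycle_edges //.
rewrite (circuitE d e n1) e1 e2 walk_cons2 walk1 edgeC.
by xor_cases.
Qed.

End Cells.

(** * Alternating paths of removed edges *)

Section Chains.
Variables (V : finType) (d : V).
Implicit Types (x y : V) (P S T l : seq V) (e : {set V}).
Implicit Types (g h : {set V} -> bool) (t b : bool).
Implicit Types (s : bool * seq V) (c : seq (bool * seq V)).

(* A segment [(t, l)] is a cycle [l] of the first ([t = true]) or second family
   whose closing edge, from the last to the first vertex of [l], is removed.  A
   chain lists the segments along an alternating path of removed edges. *)
Definition src s := head d s.2.
Definition tgt s := last d s.2.

Definition link s s' := (s'.1 == ~~ s.1) && (src s' == tgt s).

Definition chain c :=
  [&& c != [::], sorted link c & all (fun s => uniq s.2 && (2 < size s.2)) c].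

Definition verts c := if c is s :: _ then src s :: map tgt c else [::].

(** This is the long path through the opened cycles of family [t]; its links are the junctions of
    the concatenation. *)
Definition flat t c := flatten [seq s.2 | s <- c & s.1 == t].

Definition csum c e := \big[addb/false]_(s <- c) circuit s.2 e.

(** What a chain of at least three segments leaves after cancellation: two long paths, and the first
    and last removed edges, each joining an end of one path to an end of the other. *)
Definition ladder g P1 P2 :=
  [/\ uniq P1, uniq P2, 3 <= size P1 & 3 <= size P2] /\
  [/\ uniq [:: head d P1; head d P2; last d P1; last d P2] &
  forall e, g e = walk P1 e (+) walk P2 e (+) edge e (head d P1) (head d P2)
    (+) edge e (last d P1) (last d P2)].

Lemma ladder_cell_even g P1 P2 : ladder g P1 P2 ->
  cell_even d g P1 P2 [:: head d P1; head d P2; last d P1; last d P2].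
Proof.
case=> [[u1 u2 s1 s2] [u E]].
exists P1, P2, [:: head d P1; head d P2], [:: last d P1; last d P2].
do 4![split=> //]; move=> e; rewrite E !walk_cons2 !walk1.
by xor_cases.
Qed.

(* From four segments on, the last one can also be attached at the other end of
   [P2], which changes the parity. *)
Lemma ladder_cell_odd g P1 P2 l : ladder g P1 P2 ->
  2 < size l -> uniq (l ++ P2) -> head d l = last d P1 ->
  last d l \notin [:: head d P1; head d P2; last d P1; last d P2] ->
  cell_odd d (fun e => g e (+) circuit l e) P1 (l ++ P2)
    (last d l :: [:: head d P1; head d P2; last d P1; last d P2]).
Proof.
case=> [[u1 u2 s1 s2] [u E]] sl ul hl nl.
have [n1 n2 n3] := And3 (nonnil s1) (nonnil s2) (nonnil sl).
exists P1, (l ++ P2), [:: head d P1; head d P2; last d l; last d P1; last d P2].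
have pr : perm_eq [:: head d P1; head d P2; last d l; last d P1; last d P2]
    (last d l :: [:: head d P1; head d P2; last d P1; last d P2]).
  by apply/permP => p /=; rewrite [RHS]addnCA; congr (_ + _); rewrite addnCA.
split; first by split=> //; rewrite (perm_uniq pr) cons_uniq nl.
split; first by split=> //; rewrite size_cat ltn_addr.
split; first by split=> // x; rewrite (perm_mem pr).
split; rewrite ?head_cat0 ?last_cat0 // => e.
rewrite E (walk_cat d) // (circuitE d) // !walk_cons2 walk1 hl.
by rewrite (edgeC _ (last d l) (head d P2)); xor_cases.
Qed.

Lemma flat_rcons t c s :
  flat t (rcons c s) = flat t c ++ (if s.1 == t then s.2 else [::]).
Proof.
by rewrite /flat filter_rcons; case: ifP => _; rewrite ?cats0 // map_rcons flatten_rcons.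
Qed.

Lemma flat_cons t c s :
  flat t (s :: c) = (if s.1 == t then s.2 else [::]) ++ flat t c.
Proof. by rewrite /flat /=; case: ifP. Qed.

Lemma flat_cat t c c' : flat t (c ++ c') = flat t c ++ flat t c'.
Proof. by rewrite /flat filter_cat map_cat flatten_cat. Qed.

Lemma csum_rcons c s e : csum (rcons c s) e = csum c e (+) circuit s.2 e.
Proof. by rewrite /csum -cats1 big_cat big_seq1. Qed.

Lemma chain_rcons s0 c s : chain (rcons (s0 :: c) s) =
  [&& chain (s0 :: c), link (last s0 c) s, uniq s.2 & 2 < size s.2].
Proof.
rewrite /chain /= rcons_path all_rcons.
case: (path _ _ _) => //=; case: (link _ _); rewrite ?andbF //=.
by rewrite -[RHS]andbA [X in _ = _ && X]andbC.
Qed.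

(** Appending [s] after [s'] creates the link from [src s'] to [src s = tgt s'], which is the
    removed edge of [s'] and cancels it. By induction only the first and last removed edges
    survive. *)
Lemma chain_walk s0 s1 c : chain [:: s0, s1 & c] ->
  let c' := [:: s0, s1 & c] in let s := last s1 c in
  [/\ head d (flat s0.1 c') = src s0, head d (flat (~~ s0.1) c') = tgt s0,
      last d (flat s.1 c') = tgt s & last d (flat (~~ s.1) c') = src s] /\
  [/\ 2 < size (flat s0.1 c'), 2 < size (flat (~~ s0.1) c') &
  forall t e, walk (flat t c') e (+) walk (flat (~~ t) c') e =
    csum c' e (+) edge e (src s0) (tgt s0) (+) edge e (src s) (tgt s)].
Proof.
have sizes P S : 2 < size P -> 2 < size S -> (P != [::]) * (S != [::]).
  by case: P => //; case: S.
elim/last_ind: c => [|c s IH].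
  case/and3P=> _ /=; rewrite andbT => /andP[/eqP t1 /eqP e1].
  case/and3P=> /andP[u0 l0] /andP[u1 l1] _.
  have [n0 n1] := sizes _ _ l0 l1.
  have f0 : flat s0.1 [:: s0; s1] = s0.2.
    by rewrite !flat_cons t1 eqxx; case: (s0.1); rewrite /= ?cats0.
  have f1 : flat (~~ s0.1) [:: s0; s1] = s1.2.
    by rewrite !flat_cons t1 eqxx; case: (s0.1); rewrite /= ?cats0.
  rewrite t1 negbK f0 f1; split=> //; split=> // t e.
  have -> : walk (flat t [:: s0; s1]) e (+) walk (flat (~~ t) [:: s0; s1]) e
      = walk s0.2 e (+) walk s1.2 e.
    rewrite -f0 -f1; case: (s0.1); case: t => //; exact: addbC.
  rewrite /csum !big_cons big_nil !(circuitE d) // -!/(src _) -!/(tgt _).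
  rewrite (edgeC _ (tgt s0)) (edgeC _ (tgt s1)).
  by xor_cases.
rewrite -!rcons_cons chain_rcons last_rcons => /and4P[ch lk us ls].
have [[h0 h1 l1 l0] [z0 z1 E]] := IH ch.
set c0 := [:: s0, s1 & c] in h0 h1 l1 l0 z0 z1 E *.
set s' := last s1 c in l1 l0 E lk.
have {lk} [/eqP ts /eqP es] : s.1 == ~~ s'.1 /\ src s == tgt s' by apply/andP.
have zt t : 2 < size (flat t c0).
  by move: z0 z1; case: (s0.1); case: t.
have [ns n1] := sizes _ _ ls (zt s.1).
have ft : flat s.1 (rcons c0 s) = flat s.1 c0 ++ s.2.
  by rewrite flat_rcons eqxx.
have fn : flat (~~ s.1) (rcons c0 s) = flat (~~ s.1) c0.
  by rewrite flat_rcons; case: (s.1); rewrite cats0.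
have hd t : head d (flat t (rcons c0 s)) = head d (flat t c0).
  by rewrite flat_rcons head_cat0 //; apply: nonnil (zt t).
split.
  rewrite !hd; split=> //; first by rewrite ft last_cat0.
  by rewrite fn ts negbK l1 -es.
split.
- by rewrite flat_rcons size_cat ltn_addr.
- by rewrite flat_rcons size_cat ltn_addr.
move=> t e.
have -> : walk (flat t (rcons c0 s)) e (+) walk (flat (~~ t) (rcons c0 s)) e
    = walk (flat s.1 (rcons c0 s)) e (+) walk (flat (~~ s.1) (rcons c0 s)) e.
  by case: (s.1); case: t => //; exact: addbC.
rewrite ft fn (walk_cat d) // csum_rcons (circuitE d) //.
have -> : last d (flat s.1 c0) = src s' by rewrite ts l0.
rewrite -/(src s) -/(tgt s) es (edgeC _ (tgt s)).
by have := E s.1 e; xor_cases; case: (csum _ _).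
Qed.

(** The third segment makes the four ends distinct: with two segments, the target of the first is
    the source of the last. *)
Lemma chain_ladder s0 s1 c s :
  let c' := [:: s0, s1 & rcons c s] in
  chain c' -> uniq (verts c') -> (forall t, uniq (flat t c')) ->
  [/\ forall t, ladder (csum c') (flat t c') (flat (~~ t) c'),
    forall t, {subset [:: head d (flat t c'); head d (flat (~~ t) c');
        last d (flat t c'); last d (flat (~~ t) c')] <= verts c'} &
    last d (flat s.1 c') = tgt s].
Proof.
move=> c' ch uv uf; have [[h0 h1 l1 l0] [z0 z1 E]] := chain_walk ch.
rewrite -/c' last_rcons in h0 h1 l1 l0 z0 z1 E.
have zt b : 2 < size (flat b c') by move: z0 z1; case: (s0.1); case: b.
have es : src s = tgt (last s1 c).
  move: ch; rewrite /c' -!rcons_cons chain_rcons => /and4P[_ /andP[_ /eqP-> _ _]].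
  by case: (c).
have ls : tgt (last s1 c) \in map tgt (s1 :: c).
  by rewrite map_f // mem_last.
have ev : verts c' = [:: src s0, tgt s0 & rcons (map tgt (s1 :: c)) (tgt s)].
  by rewrite /c' /verts -map_rcons.
move: (map tgt (s1 :: c)) ls ev => M ls ev.
have sv : {subset [:: src s0; tgt s0; src s; tgt s] <= verts c'}.
  move=> x; rewrite ev !inE mem_rcons inE es.
  by case/or4P=> /eqP->; rewrite ?eqxx ?ls ?orbT.
have u4 : uniq [:: src s0; tgt s0; src s; tgt s].
  move: uv; rewrite ev /= !inE rcons_uniq !mem_rcons !inE !negb_or es.
  case/and3P=> /and3P[-> n1 n2] /andP[n3 n4] /andP[n5 _].
  rewrite n1 n3 andbT /=.
  have nt x y : x \notin M -> y \in M -> x != y.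
    by move=> xn yi; apply: contraNneq xn => ->.
  by rewrite andbT (nt _ _ n2 ls) (nt _ _ n4 ls) eq_sym (nt _ _ n5 ls).
have pr t : perm_eq [:: src s0; tgt s0; src s; tgt s]
    [:: head d (flat t c'); head d (flat (~~ t) c');
        last d (flat t c'); last d (flat (~~ t) c')].
  apply/permP => p /=; move: h0 h1 l1 l0.
  case: (s0.1); case: (s.1); case: t => /= -> -> -> ->;
  rewrite !addn0; first [done | by rewrite addnCA
    | by congr (_ + (_ + _)); rewrite addnC
    | by rewrite addnCA; congr (_ + (_ + _)); rewrite addnC].
split=> // [t|t x]; last by rewrite -(perm_mem (pr t)); apply: sv.
split; first by split.
rewrite -(perm_uniq (pr t)); split=> // e; rewrite E.
move: h0 h1 l1 l0; case: (s0.1); case: (s.1); case: t => /= -> -> -> ->.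
all: rewrite ?(edgeC _ (tgt s0) (src s0)) ?(edgeC _ (tgt s) (src s)).
all: by xor_cases; case: (csum _ _).
Qed.

Lemma chain_single s : chain [:: s] -> uniq (verts [:: s]) ->
  cell_single d (csum [:: s]) s.2 (verts [:: s]).
Proof.
rewrite /chain /= andbT => /andP[us ls] uv.
exists s.2, (verts [:: s]); split; split => // e.
have n := nonnil ls.
rewrite /csum big_seq1 (circuitE d) // /verts /= walk_cons2 walk1.
by rewrite addbF edgeC.
Qed.

(** The two removed edges themselves form the third path, on three vertices. *)
Lemma chain_pair s0 s1 : chain [:: s0; s1] -> uniq (verts [:: s0; s1]) ->
  cell_odd d (csum [:: s0; s1]) s0.2 s1.2 (verts [:: s0; s1]).
Proof.
move=> ch uv; have := ch; rewrite /chain /= !andbT.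
case/and3P=> /andP[_ /eqP es] /andP[us0 ls0] /andP[us1 ls1].
have [n0 n1] := (nonnil ls0, nonnil ls1).
exists s0.2, s1.2, (verts [:: s0; s1]).
do 3![split=> //]; split=> // e.
rewrite /csum !big_cons big_nil !(circuitE d) // /verts /= !walk_cons2 walk1.
rewrite -/(src s0) -/(src s1) -/(tgt s0) -/(tgt s1) es.
rewrite (edgeC _ (tgt s0) (src s0)) (edgeC _ (tgt s0) (tgt s1)).
by xor_cases.
Qed.

Lemma chain_cell_even s0 s1 c s :
  let c' := [:: s0, s1 & rcons c s] in
  chain c' -> uniq (verts c') -> (forall t, uniq (flat t c')) ->
  cell_even d (csum c') (flat true c') (flat false c') (verts c').
Proof.
move=> c' ch uv uf; have [L S _] := chain_ladder ch uv uf.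
have := ladder_cell_even (L true).
by apply: (@cell_sub _ d false) => // x; apply: S.
Qed.

Lemma verts_rcons s0 c s : verts (s0 :: rcons c s) = rcons (verts (s0 :: c)) (tgt s).
Proof. by rewrite /verts -!rcons_cons map_rcons. Qed.

Lemma chain_cell_odd s0 s1 c s s' :
  let c' := [:: s0, s1 & rcons (rcons c s) s'] in
  chain c' -> uniq (verts c') -> (forall t, uniq (flat t c')) ->
  cell_odd d (csum c') (flat true c') (flat false c') (verts c').
Proof.
move=> c' ch uv uf; pose c0 := [:: s0, s1 & rcons c s].
have ec : c' = rcons c0 s' by [].
have := ch; rewrite {1}/c' -!rcons_cons chain_rcons => /and4P[ch0].
rewrite -rcons_cons last_rcons => /andP[/eqP t' /eqP e'] us' ls'.
have ev : verts c' = rcons (verts c0) (tgt s') by rewrite /c' -rcons_cons verts_rcons.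
have uv0 : uniq (verts c0) by move: uv; rewrite ev rcons_uniq => /andP[].
have uf0 t : uniq (flat t c0).
  by have := uf t; rewrite ec flat_rcons cat_uniq => /andP[].
have [L S lst] := chain_ladder ch0 uv0 uf0; rewrite -/c0 in L S lst.
have nt : ~~ (s'.1) = s.1 by rewrite t' negbK.
have fs : flat s.1 c' = flat s.1 c0.
  by rewrite ec flat_rcons t'; case: (s.1); rewrite cats0.
have fn : flat (~~ s.1) c' = flat (~~ s.1) c0 ++ s'.2.
  by rewrite ec flat_rcons t' eqxx.
(* All segments but the last form a ladder. The last one starts where the path of family [s.1] ends,
   and is put in front of the other path instead of behind it. *)
have H : cell_odd d (csum c') (flat s.1 c') (flat (~~ s.1) c') (verts c').
  have := ladder_cell_odd (L s.1) ls'; rewrite uniq_catC -fn => /(_ (uf _)).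
  rewrite -/(src s') e' lst => /(_ erefl).
  have nv : tgt s' \notin verts c0 by move: uv; rewrite ev rcons_uniq => /andP[].
  have -> // : tgt s' \notin [:: head d (flat s.1 c0); head d (flat (~~ s.1) c0);
      tgt s; last d (flat (~~ s.1) c0)].
    by apply: contra nv => H; apply: (S s.1); rewrite lst.
  move=> /(_ isT) H.
  apply: (@cell_ext _ d true (fun e => csum c0 e (+) circuit s'.2 e)).
    by move=> e; rewrite ec csum_rcons.
  apply: (@cell_sub _ d true) H => [|x|x].
  - by rewrite fs.
  - by rewrite fn !mem_cat orbC.
  - rewrite ev mem_rcons !in_cons => /predU1P[->|xin]; first by rewrite eqxx.
    by apply/orP; right; apply: (S s.1); rewrite lst !in_cons.
move: H; case: (s.1) => // H.
exact: (@cell_swap _ d true).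
Qed.

(** Where both parities are available, that of the number of inner vertices is chosen, so that
    parities add up uniformly over all chains. *)
Lemma chain_cell c : 1 < size c -> chain c -> uniq (verts c) ->
  (forall t, uniq (flat t c)) ->
  cell d (~~ odd (size c)) (csum c) (flat true c) (flat false c) (verts c).
Proof.
move=> sc ch uv uf.
case: c sc ch uv uf => [|s0 [|s1 c]] // _.
case/lastP: c => [|c s] ch uv uf.
  rewrite /= !flat_cons; have := chain_pair ch uv.
  have : s1.1 == ~~ s0.1 by move: ch; rewrite /chain /= => /and3P[/andP[/andP[]]].
  move/eqP->; case: (s0.1); rewrite ?cats0 //.
  exact: (@cell_swap _ d true).
have ev := chain_cell_even ch uv uf.
rewrite [size _]/= size_rcons /= !negbK.
case os: (odd (size c)); last exact: ev.
by case/lastP: c ch uv uf {ev} os => // c s' ch uv uf _; apply: chain_cell_odd.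
Qed.

(** This freedom adjusts the total parity when the last cycle is treated. *)
Lemma chain_cell_any b c : 3 < size c -> chain c -> uniq (verts c) ->
  (forall t, uniq (flat t c)) ->
  cell d b (csum c) (flat true c) (flat false c) (verts c).
Proof.
case: c => [|s0 [|s1 c]] //; case/lastP: c => [|c s] //.
case/lastP: c => [|c s'] // _ ch uv uf.
by case: b; [apply: chain_cell_odd|apply: chain_cell_even].
Qed.

End Chains.

(** * Choosing the removed edges *)

Section Families.
Variables (V : finType) (d : V).
Implicit Types (x y : V) (P S T l : seq V) (e : {set V}).
Implicit Types (g h : {set V} -> bool) (t b : bool).
Implicit Types (s : bool * seq V) (c : seq (bool * seq V)).
Implicit Types (cs : seq (seq (bool * seq V))) (Ls : seq (seq V)).

Local Notation src := (src d).
Local Notation tgt := (tgt d).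
Local Notation chain := (chain d).
Local Notation verts := (verts d).
Local Notation cell := (cell d).

Definition all_verts cs := flatten (map verts cs).

Lemma csum_cat c c' e : csum (c ++ c') e = csum c e (+) csum c' e.
Proof. by rewrite /csum big_cat. Qed.

Lemma uniq_cat_l S T : uniq (S ++ T) -> uniq S.
Proof. by rewrite cat_uniq => /and3P[]. Qed.

Lemma uniq_cat_r S T : uniq (S ++ T) -> uniq T.
Proof. by rewrite cat_uniq => /and3P[]. Qed.

Lemma apart_catr S T P : apart S (T ++ P) -> apart S T /\ apart S P.
Proof.
by move=> a; split=> x xS xT; apply: (a x xS); rewrite mem_cat xT ?orbT.
Qed.

Lemma apart_catl S T P : apart S P -> apart T P -> apart (S ++ T) P.
Proof. by move=> a1 a2 x; rewrite mem_cat => /orP[/a1|/a2]; apply. Qed.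

Lemma uniq_apart S T : uniq (S ++ T) -> apart S T.
Proof.
rewrite cat_uniq => /and3P[_ /hasPn H _] x xS xT.
by have /negP := H x xT; apply.
Qed.

(** Each chain of [k] segments shifts the parity by [k - 1], including [k = 1], where a single cell
    is merged. The sum of the two sizes has the parity of their difference. *)
Lemma merge_chains b g S1 S2 T cs : cell b g S1 S2 T ->
  all chain cs -> uniq (all_verts cs) -> (forall t, uniq (flat t (flatten cs))) ->
  apart S1 (flat true (flatten cs)) -> apart S2 (flat false (flatten cs)) ->
  apart T (all_verts cs) ->
  cell (b (+) odd (size (flatten cs) + size cs))
    (fun e => g e (+) csum (flatten cs) e)
    (S1 ++ flat true (flatten cs)) (S2 ++ flat false (flatten cs))
    (T ++ all_verts cs).
Proof.
elim: cs b g S1 S2 T => [|c cs IH] b g S1 S2 T H.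
  move=> _ _ _ _ _ _; rewrite addbF /all_verts /= /flat /= !cats0.
  by apply: cell_ext H => e; rewrite /csum big_nil addbF.
move=> /andP[chc chs]; rewrite /all_verts /= -/(all_verts cs) => uv uf.
rewrite !flat_cat => /apart_catr[a1 a1'] /apart_catr[a2 a2'] /apart_catr[a3 a3'].
have {}uf t : uniq (flat t c ++ flat t (flatten cs)) by rewrite -flat_cat.
have uv' := uniq_cat_l uv.
have step b' : cell b' (fun e => g e (+) csum c e) (S1 ++ flat true c)
    (S2 ++ flat false c) (T ++ verts c) -> b' = b (+) ~~ odd (size c) ->
  cell (b (+) odd (size (c ++ flatten cs) + (size cs).+1))
    (fun e => g e (+) csum (c ++ flatten cs) e)
    (S1 ++ flat true c ++ flat true (flatten cs))
    (S2 ++ flat false c ++ flat false (flatten cs))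
    (T ++ verts c ++ all_verts cs).
  move=> H' eb; rewrite !catA.
  have -> : b (+) odd (size (c ++ flatten cs) + (size cs).+1) =
      b' (+) odd (size (flatten cs) + size cs).
    rewrite eb size_cat addnS -addnA /= oddD.
    by case: b {H IH eb}; case: (odd (size c)); case: (odd _).
  apply: (@cell_ext _ _ _
    (fun e => (g e (+) csum c e) (+) csum (flatten cs) e)).
    by move=> e; rewrite csum_cat addbA.
  apply: IH => //.
  - exact: uniq_cat_r uv.
  - by move=> t; apply: uniq_cat_r (uf t).
  - by apply: apart_catl => //; apply: uniq_apart.
  - by apply: apart_catl => //; apply: uniq_apart.
  - by apply: apart_catl => //; apply: uniq_apart.
have ufc t : uniq (flat t c) := uniq_cat_l (uf t).
have [sc|sc] := ltnP 1 (size c).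
  by apply: (step _ (merge_cell H (chain_cell sc chc uv' ufc) a1 a2 a3)).
have [s es] : exists s, c = [:: s].
  by case: c chc sc {uv uf a1 a2 a3 step ufc uv'} => [|s []] // _ _; exists s.
have I : cell_single d (csum c) s.2 (verts c) by rewrite es; apply: chain_single; rewrite -?es.
apply: (step b); last by rewrite es addbF.
have fs : flat s.1 c = s.2 by rewrite es flat_cons eqxx cats0.
have fn : flat (~~ s.1) c = [::] by rewrite es flat_cons; case: (s.1).
move: fs fn; case: (s.1) => /= fs fn; rewrite fn cats0.
  by rewrite fs; apply: merge_single => //; rewrite -fs.
apply: cell_swap; rewrite fs; apply: merge_single => //; last by rewrite -fs.
exact: cell_swap.
Qed.

(* [n] is the number of vertices on a removed edge of both families, since a chain
   of [k] segments has [k - 1] inner vertices. *)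
Definition chain_family cs FA FB g n :=
  [/\ all chain cs, uniq (all_verts cs), uniq FA & uniq FB] /\
  [/\ perm_eq (flat true (flatten cs)) FA,
      perm_eq (flat false (flatten cs)) FB,
      csum (flatten cs) =1 g & size (flatten cs) = size cs + n].

Lemma csum_perm c c' : perm_eq c c' -> csum c =1 csum c'.
Proof. by move=> pc e; rewrite /csum; apply: perm_big. Qed.

Lemma flat_perm t c c' : perm_eq c c' -> perm_eq (flat t c) (flat t c').
Proof. by move=> pc; apply: perm_flatten; apply: perm_map; apply: perm_filter. Qed.

Lemma family_perm cs cs' FA FB g n : perm_eq cs cs' ->
  chain_family cs FA FB g n -> chain_family cs' FA FB g n.
Proof.
move=> pc [[ch uv uA uB] [pA pB E sz]].
have pf := perm_flatten pc.
split; split=> //.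
- by rewrite -(perm_all _ pc).
- by rewrite -(perm_uniq (perm_flatten (perm_map verts pc))).
- by apply: perm_trans pA; rewrite perm_sym flat_perm.
- by apply: perm_trans pB; rewrite perm_sym flat_perm.
- by move=> e; rewrite -E; apply/esym/csum_perm.
- by rewrite -(perm_size pf) sz (perm_size pc).
Qed.

Lemma extract cs x : x \in all_verts cs ->
  exists c rest, perm_eq cs (c :: rest) /\ x \in verts c.
Proof.
case/flattenP=> S /mapP[c ccs ->] xc.
by exists c, (rem c cs); split=> //; apply: perm_to_rem.
Qed.

(** * Reversing and concatenating chains *)

Definition flip c : seq (bool * seq V) := rev [seq (s.1, rev s.2) | s <- c].

Definition similar c c' :=
  [/\ chain c', perm_eq (verts c') (verts c),
      forall t, perm_eq (flat t c') (flat t c),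
      csum c' =1 csum c & size c' = size c].

Lemma family_similar c c' cs FA FB g n : similar c c' ->
  chain_family (c :: cs) FA FB g n -> chain_family (c' :: cs) FA FB g n.
Proof.
move=> [ch' pv pf E' sz'] [[/andP[ch chs] uv uA uB] [pA pB E sz]].
split; split=> //.
- by apply/andP; split.
- rewrite -(perm_uniq (s1 := all_verts (c :: cs))) //.
  by rewrite /all_verts /= perm_cat2r perm_sym.
- by apply: perm_trans pA; rewrite /= !flat_cat perm_cat2r.
- by apply: perm_trans pB; rewrite /= !flat_cat perm_cat2r.
- by move=> e; rewrite -E /= !csum_cat E'.
- by rewrite -sz /= !size_cat sz'.
Qed.

Lemma chain_verts_src s c : chain (s :: c) ->
  verts (s :: c) = rcons (map src (s :: c)) (tgt (last s c)).
Proof.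
elim: c s => [|s' c IH] s // ch.
case/and3P: ch => _ /andP[/andP[_ /eqP es] so] /andP[_ al].
have /IH /= : chain (s' :: c) by apply/and3P.
by rewrite es => ->.
Qed.

Lemma similar_flip c : chain c -> similar c (flip c).
Proof.
move=> ch; have := ch => /and3P[c0 so al].
have sr s : src (s.1, rev s.2) = tgt s by rewrite /src head_rev.
have tr s : tgt (s.1, rev s.2) = src s by rewrite /tgt last_rev.
split.
- apply/and3P; split.
  + by rewrite -size_eq0 size_rev size_map size_eq0.
  + rewrite /flip rev_sorted sorted_map; apply: sub_sorted so => s s'.
    rewrite /link /= sr tr /= => /andP[/eqP-> /eqP->].
    by rewrite negbK !eqxx.
  + rewrite /flip all_rev all_map; apply: sub_all al => s /=.
    by rewrite rev_uniq size_rev.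
- case: c ch {c0 so al} => // s c ch; rewrite chain_verts_src //.
  have -> : verts (flip (s :: c)) = tgt (last s c) :: rev (map src (s :: c)).
    rewrite /flip lastI !map_rcons !rev_rcons /= sr tr.
    rewrite map_rev -map_comp; congr [:: _, _ & rev _].
    by apply: eq_map => s'; apply: tr.
  by rewrite perm_sym perm_rcons perm_cons perm_sym perm_rev.
- move=> t; rewrite /flip /flat filter_rev map_rev.
  apply: (perm_trans (perm_flatten (permEl (perm_rev _)))).
  rewrite filter_map -map_comp; elim: [seq s <- c | _] => //= s c' IH.
  by apply: perm_cat => //; rewrite perm_rev.
- move=> e; rewrite (csum_perm (c' := [seq (s.1, rev s.2) | s <- c])).
    by rewrite /csum big_map; apply: eq_bigr => s _; rewrite circuit_rev.
  by rewrite /flip perm_rev.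
- by rewrite size_rev size_map.
Qed.

Lemma similar_trans c1 c2 c3 : similar c1 c2 -> similar c2 c3 -> similar c1 c3.
Proof.
move=> [ch1 pv1 pf1 E1 z1] [ch2 pv2 pf2 E2 z2]; split=> // [|t|e|].
- exact: perm_trans pv1.
- exact: perm_trans (pf1 t).
- by rewrite E2.
- by rewrite z2.
Qed.

Lemma src_mem s : 2 < size s.2 -> src s \in s.2.
Proof. by rewrite /src; case: (s.2) => //= x l _; rewrite inE eqxx. Qed.

Lemma tgt_mem s : 2 < size s.2 -> tgt s \in s.2.
Proof. by rewrite /tgt; case: (s.2) => //= x l _; apply: mem_last. Qed.

Lemma chain_size c s : chain c -> s \in c -> 2 < size s.2.
Proof. by case/and3P=> _ _ /allP al /al/andP[]. Qed.

Lemma mem_flat c s x : s \in c -> x \in s.2 -> x \in flat s.1 c.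
Proof.
move=> sc xs; apply/flattenP; exists s.2 => //.
by apply: map_f; rewrite mem_filter eqxx.
Qed.

(** An inner vertex is the target of one segment and the source of the next, which belongs to the
    other family. *)
Lemma verts_inner s c x : chain (s :: c) -> x \in verts (s :: c) ->
  [\/ x = src s, x = tgt (last s c) | forall t, x \in flat t (s :: c)].
Proof.
elim: c s => [|s' c IH] s.
  by move=> _; rewrite /verts /= !inE => /orP[]/eqP->; [constructor 1|constructor 2].
move=> ch; have zs := chain_size ch (mem_head _ _).
have zs' : 2 < size s'.2 by apply: (chain_size ch); rewrite !inE eqxx orbT.
case/and3P: ch => _ /andP[/andP[/eqP ts /eqP es] so] /andP[_ al].
have ch' : chain (s' :: c) by apply/and3P.
rewrite inE => /orP[/eqP->|xv]; first by constructor 1.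
have {}xv : x \in verts (s' :: c) by rewrite /verts es.
case: (IH s' ch' xv) => [xs'|->|H]; [|by constructor 2|].
  constructor 3 => t; have [<-|nt] := eqVneq s.1 t.
    by apply: mem_flat; rewrite ?inE ?eqxx // xs' es tgt_mem.
  have <- : s'.1 = t by rewrite ts; move: nt; case: (s.1); case: t.
  by apply: mem_flat; rewrite ?inE ?eqxx ?orbT // xs' src_mem.
by constructor 3 => t; rewrite flat_cons mem_cat H orbT.
Qed.

(** A vertex off the first family can only be an end of its chain, on a segment of the second
    family. After a flip if necessary, a cycle of the first family can be attached there. *)
Lemma orient c x : chain c -> x \in verts c -> x \notin flat true c ->
  exists c' s, [/\ similar c (rcons c' s), tgt s = x & s.1 = false].
Proof.
case: c => // s c ch xv nx.
have out s' : s' \in s :: c -> x \in s'.2 -> s'.1 = false.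
  move=> s'c xs'; apply/negP => /idP t; move: nx => /negP; apply.
  by rewrite -t; apply: mem_flat xs'.
have sl : last s c \in s :: c := mem_last _ _.
case: (verts_inner ch xv) => [xs|xl|/(_ true)]; last by rewrite (negbTE nx).
  exists (flip c), (s.1, rev s.2); split.
  - by have := similar_flip ch; rewrite /flip /= rev_cons.
  - by rewrite /tgt last_rev.
  - apply: (out s); first exact: mem_head.
    by rewrite xs src_mem // (chain_size ch) // mem_head.
exists (belast s c), (last s c); split => //.
- by rewrite -lastI; split.
- by apply: out => //; rewrite xl tgt_mem // (chain_size ch).
Qed.

Lemma orient_head c x : chain c -> x \in verts c -> x \notin flat true c ->
  exists s c', [/\ similar c (s :: c'), src s = x & s.1 = false].
Proof.
move=> ch xv nx; have [c' [s [sim ts s1]]] := orient ch xv nx.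
have ch' : chain (rcons c' s) by case: sim.
exists (s.1, rev s.2), (flip c'); split=> //.
  apply: similar_trans sim _; have := similar_flip ch'.
  by rewrite /flip map_rcons rev_rcons.
by rewrite /src head_rev.
Qed.

Lemma chain_cat c s s' c' : chain (rcons c s) -> chain (s' :: c') ->
  link d s s' -> chain (rcons c s ++ s' :: c') /\
  verts (rcons c s ++ s' :: c') = verts (rcons c s) ++ map tgt (s' :: c').
Proof.
case/and3P=> _ so al /and3P[_ so' al'] lk; split; last first.
  by case: c {so al} => //= s0 c; rewrite map_cat.
apply/and3P; split; first by case: (c).
- case: c so {al} => [_|s0 c] /=; first by rewrite lk.
  by rewrite cat_path last_rcons => -> /=; rewrite lk.
- by rewrite all_cat al.
Qed.

(** * Adding one cycle of the first family to the chains *)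

Lemma family_ext cs FA FA' FB g h n : perm_eq FA FA' -> g =1 h ->
  chain_family cs FA FB g n -> chain_family cs FA' FB h n.
Proof.
move=> pA gh [[ch uv uA uB] [pA' pB E sz]]; split; split=> //.
- by rewrite -(perm_uniq pA).
- exact: perm_trans pA.
- by move=> e; rewrite E gh.
Qed.

(** Common bookkeeping for adding [l]: [old] lists the chains it touches, [X] the newly covered
    vertices. Replacing [size old] chains by one with one more segment raises the count by
    [size old]. *)
Lemma family_replace old new cs FA FB g n l X :
  chain_family (old ++ cs) FA FB g n -> uniq l -> apart l FA -> uniq X ->
  apart X (all_verts (old ++ cs)) ->
  [/\ chain new, perm_eq (verts new) (X ++ all_verts old),
      perm_eq (flat true new) (l ++ flat true (flatten old)),
      perm_eq (flat false new) (flat false (flatten old)) &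
      csum new =1 (fun e => csum (flatten old) e (+) circuit l e)
      /\ size new = (size (flatten old)).+1] ->
  chain_family (new :: cs) (l ++ FA) FB (fun e => g e (+) circuit l e) (n + size old) /\
  all_verts (new :: cs) =i X ++ all_verts (old ++ cs).
Proof.
move=> [[ch uv uA uB] [pA pB E sz]] ul al uX aX [ch' pv pt pf [E' sz']].
have av : perm_eq (all_verts (new :: cs)) (X ++ all_verts (old ++ cs)).
  by rewrite /all_verts /= map_cat flatten_cat catA perm_cat2r.
split; last exact: perm_mem.
split; split.
- by move: ch; rewrite all_cat /= ch' => /andP[_ ->].
- by rewrite (perm_uniq av); apply: uniq_cat_apart aX _ _ _ _.
- by apply: uniq_cat_apart al _ _ _ _.
- by [].
- rewrite /= flat_cat; apply: (@perm_trans _ (l ++ flat true (flatten (old ++ cs)))).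
    by rewrite flatten_cat flat_cat catA perm_cat2r.
  by rewrite perm_cat2l.
- rewrite /= flat_cat; apply: perm_trans pB.
  by rewrite flatten_cat flat_cat perm_cat2r.
- move=> e; rewrite /= csum_cat E' -E flatten_cat csum_cat.
  by case: (csum _ e); case: (csum _ e); case: (circuit _ _).
- move: sz; rewrite /= flatten_cat !size_cat sz' /= => sz.
  by rewrite addSn sz addSn; congr _.+1; rewrite (addnC (size old)) -addnA (addnC (size old)).
Qed.

Lemma all_verts_perm cs cs' : perm_eq cs cs' -> all_verts cs =i all_verts cs'.
Proof. by move=> pc; apply/perm_mem/perm_flatten/perm_map. Qed.

Lemma all_verts_similar c c' cs : similar c c' ->
  all_verts (c' :: cs) =i all_verts (c :: cs).
Proof. by case=> _ pv _ _ _ x; rewrite /all_verts /= !mem_cat (perm_mem pv). Qed.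

Lemma flat_family cs FA FB g n c x :
  chain_family cs FA FB g n -> c \in cs -> x \notin FA -> x \notin flat true c.
Proof.
move=> [_ [pA _ _ _]] ccs; apply: contra => xc; rewrite -(perm_mem pA).
case/flattenP: xc => S /mapP[s]; rewrite mem_filter => /andP[s1 sc] -> xs.
rewrite -(eqP s1); apply: mem_flat xs.
by apply/flattenP; exists c.
Qed.

Lemma head_neq_last l : uniq l -> 1 < size l -> head d l != last d l.
Proof.
case: l => [|x [|y l]] //= /andP[xl _] _.
by apply: contraNneq xl => ->; apply: mem_last.
Qed.

Lemma head_mem l : 0 < size l -> head d l \in l.
Proof. by case: l => //= x l _; apply: mem_head. Qed.

Lemma last_mem l : 0 < size l -> last d l \in l.
Proof. by case: l => //= x l _; apply: mem_last. Qed.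

Lemma chain_segment s : uniq s.2 -> 2 < size s.2 -> chain [:: s].
Proof. by move=> us ls; apply/and3P; split=> //=; rewrite us ls. Qed.

Lemma family_isolated cs FA FB g n l :
  chain_family cs FA FB g n -> uniq l -> 2 < size l -> apart l FA ->
  head d l \notin all_verts cs -> last d l \notin all_verts cs ->
  exists cs', chain_family cs' (l ++ FA) FB (fun e => g e (+) circuit l e) n /\
    all_verts cs' =i [:: head d l, last d l & all_verts cs].
Proof.
move=> F ul sl al hn ln.
have [|||F' E] := @family_replace [::] [:: (true, l)] cs FA FB g n l
    [:: head d l; last d l] F ul al.
- by rewrite /= andbT inE head_neq_last // ltnW.
- by move=> x; rewrite !inE => /orP[] /eqP->; [rewrite (negbTE hn)|rewrite (negbTE ln)].
- split=> //; first exact: chain_segment.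
  by split=> // e; rewrite /csum big_seq1 big_nil.
by exists ([:: (true, l)] :: cs); split=> //; rewrite addn0 in F'.
Qed.

Lemma family_extend cs FA FB g n l :
  chain_family cs FA FB g n -> uniq l -> 2 < size l -> apart l FA ->
  head d l \in all_verts cs -> last d l \notin all_verts cs ->
  exists cs', chain_family cs' (l ++ FA) FB (fun e => g e (+) circuit l e) n.+1 /\
    all_verts cs' =i [:: head d l, last d l & all_verts cs].
Proof.
move=> F ul sl al hc ln; have [c [rest [pc hvc]]] := extract hc.
have ccs : c \in cs by rewrite (perm_mem pc) mem_head.
have hFA : head d l \notin FA.
  by apply/negP => /(al _ (head_mem (ltnW (ltnW sl)))).
have ch : chain c by case: F => [[/allP/(_ c ccs)]].
have [c' [s [sim ts s1]]] := orient ch hvc (flat_family F ccs hFA).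
have chc : chain (rcons c' s) by case: sim.
have Ec := all_verts_similar rest sim.
have E1 := all_verts_perm pc.
have Fc := family_similar sim (family_perm pc F).
have lk : link d s (true, l) by rewrite /link s1 eqxx /= ts.
have [chn vn] := chain_cat chc (chain_segment (s := (true, l)) ul sl) lk.
have [|||F' E] := @family_replace [:: rcons c' s]
    (rcons c' s ++ [:: (true, l)]) rest FA FB g n l [:: last d l] Fc ul al.
- by [].
- move=> x; rewrite inE Ec => /eqP->; rewrite -E1.
  by rewrite (negbTE ln).
- split=> //.
  + by rewrite vn /= /all_verts /= cats0 perm_catC.
  + by rewrite !flat_cat /= cats0 flat_cons /= cats0 perm_catC.
  + by rewrite flat_cat /= cats0 flat_cons /= cats0.
  + split=> [e|]; last by rewrite /= cats0 size_cat addn1.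
    by rewrite /= cats0 csum_cat /csum big_seq1.
exists ((rcons c' s ++ [:: (true, l)]) :: rest); rewrite addn1 in F'.
split=> // x; rewrite E mem_cat mem_seq1 Ec -E1 !in_cons.
have [->|] := eqVneq x (head d l); last by [].
by rewrite hc !orbT.
Qed.

(** The opened cycle connects two chains; the last hypothesis keeps its removed edge from closing a
    cycle with a single chain. *)
Lemma family_join cs FA FB g n l :
  chain_family cs FA FB g n -> uniq l -> 2 < size l -> apart l FA ->
  head d l \in all_verts cs -> last d l \in all_verts cs ->
  (forall c, c \in cs -> head d l \in verts c -> last d l \in verts c -> False) ->
  exists cs', chain_family cs' (l ++ FA) FB (fun e => g e (+) circuit l e) n.+2 /\
    all_verts cs' =i [:: head d l, last d l & all_verts cs].
Proof.
move=> F ul sl al hc lc good; have [c [rest [pc hvc]]] := extract hc.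
have ccs : c \in cs by rewrite (perm_mem pc) mem_head.
have E1 := all_verts_perm pc.
have lr : last d l \in all_verts rest.
  move: lc; rewrite E1 mem_cat => /orP[lvc|//].
  by case: (good c ccs hvc lvc).
have [c2 [rest2 [pc2 hvc2]]] := extract lr.
have pc3 : perm_eq cs [:: c, c2 & rest2].
  by apply: perm_trans pc _; rewrite perm_cons.
have c2cs : c2 \in cs by rewrite (perm_mem pc3) !inE eqxx orbT.
have hFA : head d l \notin FA.
  by apply/negP => /(al _ (head_mem (ltnW (ltnW sl)))).
have lFA : last d l \notin FA.
  by apply/negP => /(al _ (last_mem (ltnW (ltnW sl)))).
have [/allP chs _ _ _] := F.1.
have [c' [s [sim ts s1]]] := orient (chs _ ccs) hvc (flat_family F ccs hFA).
have [s' [c2' [sim2 es' s1']]] :=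
  orient_head (chs _ c2cs) hvc2 (flat_family F c2cs lFA).
have chc : chain (rcons c' s) by case: sim.
have chc2 : chain (s' :: c2') by case: sim2.
have F1 := family_similar sim (family_perm pc3 F).
have swap u v : perm_eq [:: u, v & rest2] [:: v, u & rest2].
  by apply/permP => p /=; rewrite addnCA.
have F2 := family_perm (swap _ _) (family_similar sim2 (family_perm (swap _ _) F1)).
have E3 : all_verts [:: rcons c' s, s' :: c2' & rest2] =i all_verts cs.
  move=> x; rewrite (all_verts_similar _ sim) (all_verts_perm (swap _ _)).
  by rewrite (all_verts_similar _ sim2) (all_verts_perm (swap _ _)) (all_verts_perm pc3).
have lk2 : link d (true, l) s' by rewrite /link s1' /= es'.
have [chn2 vn2] := chain_cat (c := [::])
  (chain_segment (s := (true, l)) ul sl) chc2 lk2.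
have lk : link d s (true, l) by rewrite /link s1 eqxx /= ts.
have [chn vn] := chain_cat chc chn2 lk.
set new := rcons c' s ++ _ in chn vn.
have vnew : verts new = verts (rcons c' s) ++ verts (s' :: c2').
  by rewrite vn /= es'.
have [|||F' E] := @family_replace [:: rcons c' s; s' :: c2']
    new rest2 FA FB g n l [::] F2 ul al.
- by [].
- by [].
- split=> //.
  + by rewrite vnew /all_verts /= cats0.
  + rewrite /new /= cats0 !flat_cat !flat_cons /=. by rewrite perm_catCA.
  + by rewrite /new /= cats0 !flat_cat !flat_cons.
  + split=> [e|]; last by rewrite /new /= cats0 !size_cat /= addnS.
    rewrite /new /= cats0 !csum_cat /csum !big_cons.
    by case: (circuit l e); rewrite ?addbT ?addbF // addbN.
exists (new :: rest2); rewrite addn2 in F'.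
split=> // x; rewrite E /= E3 !in_cons.
have [->|_] := eqVneq x (head d l); first by rewrite hc.
by have [->|_] := eqVneq x (last d l); first by rewrite lc.
Qed.

Lemma family_add cs FA FB g n l :
  chain_family cs FA FB g n -> uniq l -> 2 < size l -> apart l FA ->
  (forall c, c \in cs -> head d l \in verts c -> last d l \in verts c -> False) ->
  exists cs', chain_family cs' (l ++ FA) FB (fun e => g e (+) circuit l e)
      (n + (head d l \in all_verts cs) + (last d l \in all_verts cs)) /\
    all_verts cs' =i [:: head d l, last d l & all_verts cs].
Proof.
move=> F ul sl al good.
have [hc|hn] := boolP (head d l \in all_verts cs);
  have [lc|ln] := boolP (last d l \in all_verts cs); rewrite ?addn1 ?addn0.
- exact: family_join.
- exact: family_extend.
(* Only the last vertex of [l] is covered, so the reversed cycle extends the chain. *)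
- have al' : apart (rev l) FA by move=> x; rewrite mem_rev => /al.
  have [||||cs' [F' E]] := family_extend (l := rev l) F _ _ al'.
  + by rewrite rev_uniq.
  + by rewrite size_rev.
  + by rewrite head_rev.
  + by rewrite last_rev.
  exists cs'; split; last first.
    by move=> x; rewrite E head_rev last_rev !in_cons orbCA.
  apply: family_ext F' => [|e]; last by rewrite circuit_rev.
  by rewrite perm_cat2r perm_rev.
- exact: family_isolated.
Qed.


(** * Building a family of chains and reading off a cell *)

Definition circuits Ls e := \big[addb/false]_(a <- Ls) circuit a e.

Definition long_cycles Ls := all (fun a => 2 < size a) Ls.

Lemma family_uniq_flat cs FA FB g n t : chain_family cs FA FB g n ->
  uniq (flat t (flatten cs)).
Proof.
by case=> [[_ _ uA uB] [pA pB _ _]]; case: t;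
  [rewrite (perm_uniq pA)|rewrite (perm_uniq pB)].
Qed.

Lemma cell_of_head b c rest FA FB g n : chain_family (c :: rest) FA FB g n ->
  cell b (csum c) (flat true c) (flat false c) (verts c) ->
  exists S1 S2 T, cell (b (+) odd (size (flatten rest) + size rest)) g S1 S2 T.
Proof.
move=> F C; have uf t := family_uniq_flat t F.
have [[/andP[chc chr] uv _ _] [_ _ E _]] := F.
have ufr t : uniq (flat t (flatten rest)).
  by apply: (uniq_cat_r (S := flat t c)); rewrite -flat_cat.
have a t : apart (flat t c) (flat t (flatten rest)).
  by apply: uniq_apart; rewrite -flat_cat.
have M := merge_chains C chr (uniq_cat_r uv) ufr (a true) (a false) (uniq_apart uv).
do 3!eexists; apply: cell_ext M => e.
by rewrite -csum_cat -E.
Qed.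

(** If [n] is positive, some chain has at least two segments. Its cell is the starting point into
    which the other chains are merged. *)
Lemma cell_of_family cs FA FB g n : chain_family cs FA FB g n -> 0 < n ->
  exists S1 S2 T, cell (odd n) g S1 S2 T.
Proof.
move=> F n0; have [[chs _ _ _] [_ _ _ sz]] := F.
have [c ccs sc] : exists2 c, c \in cs & 1 < size c.
  apply/hasP; apply: contraTT n0 => /hasPn H; rewrite -eqn0Ngt.
  have: size (flatten cs) <= size cs.
    elim: (cs) H => //= c cs' IH H; rewrite size_cat -addn1 addnC leq_add //.
      by apply: IH => c' c'cs; apply: H; rewrite inE c'cs orbT.
    by rewrite leqNgt H // mem_head.
  by rewrite sz -{2}[size cs]addn0 leq_add2l leqn0.
have pc := perm_to_rem ccs; set rest := rem c cs in pc.
have F' := family_perm pc F; have [[/andP[chc _] uv _ _] [_ _ _ sz']] := F'.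
have uf t : uniq (flat t c).
  apply: (uniq_cat_l (T := flat t (flatten rest))); rewrite -flat_cat.
  exact: family_uniq_flat F'.
have := cell_of_head F' (chain_cell sc chc (uniq_cat_l uv) uf).
have -> // : ~~ odd (size c) (+) odd (size (flatten rest) + size rest) = odd n.
move: sz'; rewrite /= size_cat => /(congr1 odd).
rewrite addSn /= !oddD.
by case: (odd (size c)); case: (odd (size (flatten rest)));
  case: (odd (size rest)); case: (odd n).
Qed.

(** Of the two edges of the cycle at [x], at most one leads to [z]; the other one is removed. *)
Lemma opening S x z : uniq S -> 2 < size S -> x \in S -> z != x ->
  exists l, [/\ perm_eq l S, circuit l =1 circuit S, head d l = x & last d l != z].
Proof.
move=> uS sS xS zx; case/rot_to: xS => i r er.
have pr : perm_eq (x :: r) S by rewrite -er perm_rot.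
have Er e : circuit (x :: r) e = circuit S e by rewrite -er circuit_rot.
have [lz|lz] := eqVneq (last d (x :: r)) z; last by exists (x :: r).
exists (x :: rev r); split=> //.
- by apply: perm_trans pr; rewrite perm_cons perm_rev.
- by move=> e; rewrite -Er -circuit_rev rev_cons revK -cats1 circuit_catC.
have := uS; rewrite -(perm_uniq pr) => /andP[_ ur].
have : 1 < size r by move: sS; rewrite -(perm_size pr).
case: r lz ur {er pr Er} => [|u [|v r]] //= <- /andP[ur _] _.
rewrite rev_cons last_rcons; apply: contraNneq ur => ->.
exact: mem_last.
Qed.

(** Each cycle of the second family is opened at its vertex in [W] if there is one, and away from
    [z]. All chains have one segment, whence the count 0. *)
Lemma initial_family Ls (W : pred V) z :
  uniq (flatten Ls) -> long_cycles Ls -> ~~ W z ->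
  (forall a, a \in Ls -> {in a &, forall u v, W u -> W v -> u = v}) ->
  exists cs, [/\ chain_family cs [::] (flatten Ls) (circuits Ls) 0,
    z \notin all_verts cs,
    forall u, u \in flatten Ls -> W u -> u \in all_verts cs &
    {subset all_verts cs <= flatten Ls}].
Proof.
move=> + + Wz; elim: Ls => [|a Ls IH] /=.
  move=> _ _ _; exists [::]; split=> //; split; split=> // e.
  by rewrite /csum /circuits !big_nil.
move=> uL /andP[sa sL] WL.
have ua := uniq_cat_l uL; have uL' := uniq_cat_r uL.
have [|cs [F zn Wc sub]] := IH uL' sL.
  by move=> a' a'L; apply: WL; rewrite inE a'L orbT.
have [x [xa xz Wx]] : exists x, [/\ x \in a, z != x &
    forall u, u \in a -> W u -> u = x].
  have [/hasP[x xa Wx]|/hasPn nW] := boolP (has W a).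
    exists x; split=> // [|u ua' Wu]; first by apply: contraNneq Wz => ->.
    by apply: (WL a); rewrite ?mem_head.
  case: a sa ua {uL WL} nW => [|x [|y a]] // _ ua nW.
  have nW' u : u \in [:: x, y & a] -> W u -> False.
    by move=> /nW /negP.
  have [zx|zx] := eqVneq z x; last first.
    by exists x; split; rewrite ?mem_head // => u /nW' H /H.
  exists y; split; first by rewrite !inE eqxx orbT.
    by rewrite zx; move: ua; rewrite /= !inE negb_or => /andP[/andP[]].
  by move=> u /nW' H /H.
have [l [pl El hl ll]] := opening ua sa xa xz.
have sl : 2 < size l by rewrite (perm_size pl).
have ul : uniq l by rewrite (perm_uniq pl).
have la : last d l \in a by rewrite -(perm_mem pl) last_mem // ltnW // ltnW.
have av : all_verts ([:: (false, l)] :: cs) = [:: x, last d l & all_verts cs].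
  by rewrite /all_verts /= /src /tgt /= hl.
exists ([:: (false, l)] :: cs); rewrite av; split.
- have [[chs uv _ _] [pA pB E sz]] := F.
  split; split=> //.
  + by apply/andP; split=> //; apply: chain_segment.
  + rewrite av -[uniq _]/(uniq ([:: x; last d l] ++ all_verts cs)).
    apply: uniq_cat_apart (uniq_apart uL) _ uv _ sub.
      by rewrite /= andbT inE -hl head_neq_last // ltnW.
    by move=> u; rewrite !inE => /orP[]/eqP->.
  + by rewrite /= flat_cons; apply: perm_cat.
  + move=> e; rewrite /= -cat1s csum_cat E /circuits big_cons.
    by rewrite /csum big_seq1 El.
  + by rewrite /= sz.
- by rewrite !inE !negb_or xz zn andbT eq_sym.
- move=> u; rewrite mem_cat !inE => /orP[uia Wu|ufl Wu].
    by rewrite (Wx _ uia Wu) eqxx.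
  by rewrite (Wc u) ?orbT.
- move=> u; rewrite !inE mem_cat => /or3P[/eqP->|/eqP->|/sub->].
  + by rewrite xa.
  + by rewrite la.
  + by rewrite orbT.
Qed.

Lemma family_verts_inj cs FA FB g n c c' x : chain_family cs FA FB g n ->
  c \in cs -> c' \in cs -> x \in verts c -> x \in verts c' -> c = c'.
Proof.
move=> F ccs c'cs xc xc'; have := family_perm (perm_to_rem ccs) F.
case=> [[_ uv _ _] _]; apply/eqP; move: c'cs.
rewrite (perm_mem (perm_to_rem ccs)) inE => /predU1P[->//|c'r].
case: (uniq_apart uv xc); apply/flattenP; exists (verts c') => //.
exact: map_f.
Qed.

(* Only the two ends of a chain are not covered by segments of both kinds. *)
Lemma family_three cs FA FB g n c x y z : chain_family cs FA FB g n ->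
  c \in cs -> x \in verts c -> y \in verts c -> z \in verts c ->
  x \notin FA -> y \notin FA -> z \notin FA ->
  x != y -> y != z -> x != z -> False.
Proof.
move=> F ccs; have [/allP/(_ c ccs) ch _ _ _] := F.1.
case: c ch ccs => // s c ch ccs xc yc zc xA yA zA xy yz xz.
have K w : w \in verts (s :: c) -> w \notin FA -> w = src s \/ w = tgt (last s c).
  move=> wc /(flat_family F ccs) nw.
  by case: (verts_inner ch wc) => [|| /(_ true) H]; [left|right|rewrite H in nw].
have [X|X] := K x xc xA; have [Y|Y] := K y yc yA; have [Z|Z] := K z zc zA;
  by move: xy yz xz; rewrite X Y Z eqxx.
Qed.

(* At most one of the two edges at [y] closes a chain. *)
Lemma family_add_cycle cs FA FB g n S y :
  chain_family cs FA FB g n -> uniq S -> 2 < size S -> apart S FA -> y \in S ->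
  exists cs' n', [/\ chain_family cs' (S ++ FA) FB (fun e => g e (+) circuit S e) n',
    {subset all_verts cs <= all_verts cs'},
    {subset all_verts cs' <= S ++ all_verts cs} &
    n + (y \in all_verts cs) <= n'].
Proof.
move=> F uS sS aS yS; case/rot_to: (yS) => i r er.
have pr : perm_eq (y :: r) S by rewrite -er perm_rot.
have Er e : circuit (y :: r) e = circuit S e by rewrite -er circuit_rot.
have use l : perm_eq l S -> circuit l =1 circuit S ->
    y = head d l \/ y = last d l ->
    ~~ has (fun c => (head d l \in verts c) && (last d l \in verts c)) cs ->
  exists cs' n', [/\ chain_family cs' (S ++ FA) FB (fun e => g e (+) circuit S e) n',
    {subset all_verts cs <= all_verts cs'},
    {subset all_verts cs' <= S ++ all_verts cs} &
    n + (y \in all_verts cs) <= n'].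
  move=> pl El yl /hasPn good.
  have ul : uniq l by rewrite (perm_uniq pl).
  have sl : 2 < size l by rewrite (perm_size pl).
  have al : apart l FA by move=> x; rewrite (perm_mem pl) => /aS.
  have [|cs' [F' E]] := family_add F ul sl al.
    by move=> c /good /negP H hc lc; apply: H; rewrite hc.
  exists cs', (n + (head d l \in all_verts cs) + (last d l \in all_verts cs)).
  split.
  - by apply: family_ext F'; [rewrite perm_cat2r|move=> e; rewrite El].
  - by move=> x xv; rewrite E !inE xv !orbT.
  - move=> x; rewrite E !inE mem_cat -(perm_mem pl) => /or3P[/eqP->|/eqP->|->].
    + by rewrite head_mem // ltnW // ltnW.
    + by rewrite last_mem // ltnW // ltnW.
    + by rewrite orbT.
  - by case: yl => ->; [rewrite leq_addr|rewrite addnAC leq_addr].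
have ur : uniq (y :: r) by rewrite (perm_uniq pr).
have sr : 2 < size (y :: r) by rewrite (perm_size pr).
case: r {er} pr Er ur sr => [|z r] // pr Er ur sr.
pose l2 := rcons (z :: r) y.
have p2 : perm_eq l2 S by rewrite -(perm_rcons y) in pr.
have E2 : circuit l2 =1 circuit S.
  by move=> e; rewrite -Er /l2 -cats1 circuit_catC.
have [H1|] := boolP (has (fun c =>
    (head d [:: y, z & r] \in verts c) && (last d [:: y, z & r] \in verts c)) cs);
  last by apply: use => //; left.
have [H2|] := boolP (has (fun c =>
    (head d l2 \in verts c) && (last d l2 \in verts c)) cs);
  last by apply: use => //; right; rewrite last_rcons.
case/hasP: H1 => c ccs /andP[yc xc]; case/hasP: H2 => c' c'cs.
rewrite last_rcons => /andP[zc' yc'].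
(* If both edges at [y] closed a chain, it would be the same chain, containing [y] and both its
   neighbours on the cycle, all outside [FA]. *)
have ec := family_verts_inj F ccs c'cs yc yc'; rewrite -ec in zc'.
have nA x : x \in [:: y, z & r] -> x \notin FA.
  by rewrite (perm_mem pr) => xS; apply/negP => /(aS x xS).
have xr : last z r \in r by case: (r) sr => //= u r' _; apply: mem_last.
move: ur; rewrite /= !inE !negb_or -andbA => /and4P[yz yr zr _].
have zl : z != last z r by apply: contraNneq zr => {1}->.
have yl : y != last z r by apply: contraNneq yr => {1}->.
have yA : y \notin FA by rewrite nA ?mem_head.
have zA : z \notin FA by rewrite nA // !inE eqxx orbT.
have lA : last z r \notin FA by rewrite nA // !inE xr !orbT.
by case: (family_three F ccs yc zc' xc yA zA lA yz zl yl).
Qed.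

(** Opening the cycle through [w] at [w] puts a vertex that is already covered on another removed
    edge, which makes the count positive. *)
Lemma family_add_cycles cs FA FB g n Ls w :
  chain_family cs FA FB g n -> uniq (flatten Ls) -> long_cycles Ls ->
  apart (flatten Ls) FA ->
  exists cs' n', [/\
    chain_family cs' (flatten Ls ++ FA) FB (fun e => g e (+) circuits Ls e) n',
    {subset all_verts cs <= all_verts cs'},
    {subset all_verts cs' <= flatten Ls ++ all_verts cs} &
    (w \in flatten Ls) && (w \in all_verts cs) <= n' /\ n <= n'].
Proof.
move=> F; elim: Ls => [|S Ls IH] /=.
  move=> _ _ _; exists cs, n; split=> //.
  by apply: family_ext F => // e; rewrite /circuits big_nil addbF.
move=> uL /andP[sS sL] aL.
have uS := uniq_cat_l uL; have aSL := uniq_apart uL.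
have [|cs1 [n1 [F1 sub1 sup1 [w1 le1]]]] := IH (uniq_cat_r uL) sL.
  by move=> x xL; apply: aL; rewrite mem_cat xL orbT.
have aS : apart S (flatten Ls ++ FA).
  move=> x xS; rewrite mem_cat => /orP[/(aSL x xS)//|].
  by apply: aL; rewrite mem_cat xS.
pose y := if w \in S then w else head d S.
have yS : y \in S by rewrite /y; case: ifP => // _; rewrite head_mem // ltnW // ltnW.
have [cs2 [n2 [F2 sub2 sup2 le2]]] := family_add_cycle F1 uS sS aS yS.
exists cs2, n2; split.
- rewrite -catA; apply: family_ext F2 => // e.
  by rewrite /circuits big_cons -addbA [_ (+) circuit S e]addbC.
- by move=> x /sub1/sub2.
- move=> x /sup2; rewrite !mem_cat => /orP[->//|/sup1].
  by rewrite mem_cat => /orP[]->; rewrite ?orbT.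
split; last by rewrite (leq_trans le1) // (leq_trans _ le2) // leq_addr.
rewrite mem_cat; have [wS|wS] /= := boolP (w \in S).
  have [wv|//] := boolP (w \in all_verts cs).
  by rewrite (leq_trans _ le2) // /y wS sub1 // addn1.
by rewrite (leq_trans w1) // (leq_trans _ le2) // leq_addr.
Qed.

Lemma csum_mem c e : csum c e -> exists2 s, s \in c & circuit s.2 e.
Proof.
elim: c => [|s c IH]; first by rewrite /csum big_nil.
rewrite -cat1s csum_cat {1}/csum big_seq1.
have [cs _|_ /IH[s' s'c ce]] := boolP (circuit s.2 e).
  by exists s; rewrite ?mem_head.
by exists s'; rewrite // inE s'c orbT.
Qed.

(* Removing [xy] or [yz] gives different parities.  If [xy] would close a chain
   with at least three segments, then removing [yz] extends that chain to one with
   at least four, whose parity is free. *)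
Lemma family_last_cycle cs FA FB g n S i x y z r b :
  chain_family cs FA FB g n -> uniq S -> 2 < size S -> apart S FA ->
  rot i S = [:: x, y, z & r] -> x \in all_verts cs -> z \notin all_verts cs ->
  (forall e, circuit S e -> g e = false) -> (~~ b -> 0 < n) ->
  exists S1 S2 T, cell b (fun e => g e (+) circuit S e) S1 S2 T.
Proof.
move=> F uS sS aS er xv zv disj bn.
have pr : perm_eq [:: x, y, z & r] S by rewrite -er perm_rot.
have Er e : circuit [:: x, y, z & r] e = circuit S e by rewrite -er circuit_rot.
have ur : uniq [:: x, y, z & r] by rewrite (perm_uniq pr).
have opens l : perm_eq l [:: x, y, z & r] -> circuit l =1 circuit [:: x, y, z & r] ->
    [/\ uniq l, 2 < size l, apart l FA & circuit l =1 circuit S].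
  move=> pl El; split=> [|||e]; last by rewrite El Er.
  - by rewrite (perm_uniq pl).
  - by rewrite (perm_size pl).
  - by move=> u; rewrite (perm_mem pl) (perm_mem pr) => /aS.
have final l : perm_eq l [:: x, y, z & r] ->
    circuit l =1 circuit [:: x, y, z & r] ->
    ~~ has (fun c => (head d l \in verts c) && (last d l \in verts c)) cs ->
    odd (n + (head d l \in all_verts cs) + (last d l \in all_verts cs)) = b ->
    exists S1 S2 T, cell b (fun e => g e (+) circuit S e) S1 S2 T.
  move=> pl El /hasPn good pb; have [ul sl al ElS] := opens l pl El.
  have [|cs' [F' _]] := family_add F ul sl al.
    by move=> c /good /negP H hc lc; apply: H; rewrite hc.
  rewrite -pb; have [|S1 [S2 [T C]]] := cell_of_family F'.
    case: (b) bn pb => [_|/(_ isT)]; first exact: odd_gt0.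
    by rewrite -!addnA => nn _; rewrite ltn_addr.
  by exists S1, S2, T; apply: cell_ext C => e; rewrite ElS.
(* This opening removes [yz]. It never closes a chain because [z] is not covered. *)
pose l2 := [:: z & r] ++ [:: x; y].
have p2 : perm_eq l2 [:: x, y, z & r] by rewrite perm_catC.
have E2 : circuit l2 =1 circuit [:: x, y, z & r].
  by move=> e; rewrite /l2 circuit_catC.
have h2 : head d l2 = z by [].
have t2 : last d l2 = y by rewrite last_cat.
have good2 : ~~ has (fun c => (head d l2 \in verts c) && (last d l2 \in verts c)) cs.
  apply/hasPn => c ccs; rewrite h2; apply: contra zv => /andP[zc _].
  by apply/flattenP; exists (verts c) => //; apply: map_f.
have [p2b|] := boolP (odd (n + (y \in all_verts cs)) == b).
  by apply: (final l2) => //; rewrite h2 t2 (negbTE zv) addn0 (eqP p2b).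
rewrite -addbN => p1b.
(* This opening removes [xy]; since [x] is covered, the parity is the other one. *)
pose l1 := [:: y, z & r] ++ [:: x].
have p1 : perm_eq l1 [:: x, y, z & r] by rewrite perm_catC.
have E1 : circuit l1 =1 circuit [:: x, y, z & r].
  by move=> e; rewrite /l1 circuit_catC.
have h1 : head d l1 = y by [].
have t1 : last d l1 = x by rewrite last_cat.
have [|good1] := boolP (has (fun c =>
    (head d l1 \in verts c) && (last d l1 \in verts c)) cs); last first.
  apply: (final l1) => //; rewrite h1 t1 xv addn1 /=.
  by move: p1b; case: (odd _); case: (b).
case/hasP=> c ccs; rewrite h1 t1 => /andP[yc xc].
have nA u : u \in [:: x, y, z & r] -> u \notin FA.
  by rewrite (perm_mem pr) => uS'; apply/negP => /(aS u uS').
have [xA yA] : x \notin FA /\ y \notin FA.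
  by split; apply: nA; rewrite !inE eqxx ?orbT.
have [/allP/(_ c ccs) ch _ _ _] := F.1.
have [c' [s [sim ts s1]]] := orient ch yc (flat_family F ccs yA).
have pc := perm_to_rem ccs; set rest := rem c cs in pc.
have F1 := family_similar sim (family_perm pc F).
have chc : chain (rcons c' s) by case: sim.
have xv' : x \in verts (rcons c' s) by case: sim => _ pv _ _ _; rewrite (perm_mem pv).
have xy : x != y by move: ur; rewrite /= !inE !negb_or => /andP[/and3P[]].
have nx : x \notin flat true (rcons c' s) by apply: (flat_family F1); rewrite ?mem_head.
(* The chain runs from [x] to [y], and both its end segments belong to the second family, so their
   number is odd. It is not 1, because [xy] is an edge of [S]. *)
have long : 2 < size (rcons c' s).
  have so w c0 : chain (w :: c0) -> x \in verts (w :: c0) ->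
      x \notin flat true (w :: c0) -> tgt (last w c0) = y -> x = src w.
    move=> chw xw nw tl; case: (verts_inner chw xw) => [//|xt|/(_ true) H].
      by move: xy; rewrite xt tl eqxx.
    by rewrite H in nw.
  rewrite size_rcons; case: c' chc xv' nx F1 {sim} => [|s0 [|//]] chc xv' nx F1.
    exfalso; have xs := so _ _ chc xv' nx ts.
    have [us ls] : uniq s.2 /\ 2 < size s.2.
      by case/and3P: chc => _ _ /andP[/andP[]].
    have cs0 : circuit s.2 [set x; y].
      apply: (@circuit_last_head _ d) => //.
      by rewrite -/(tgt s) -/(src s) ts -xs edgeC /edge.
    have [ul1 sl1 _ El1] := opens l1 p1 E1.
    have: g [set x; y] = false.
      by apply: disj; rewrite -El1; apply: (@circuit_last_head _ d) => //; rewrite t1 h1 /edge.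
    have [[_ _ uA uB] [pA pB <- _]] := F1.
    (* As [g] vanishes on [xy], a second segment must contain that edge, hence [x]; but [x] lies on
       no cycle in [FA] and on only one of the second family. *)
    rewrite /= -cat1s csum_cat {1}/csum big_seq1 cs0 addTb => /negbFE/csum_mem[s' s'r cs'].
    have xs' : x \in s'.2 by apply: circuit_mem cs' _; rewrite !inE eqxx.
    have xf := mem_flat s'r xs'; move: xf; case: (s'.1) => xf.
      move: xA; rewrite -(perm_mem pA) => /negP; apply.
      by rewrite /= -cat1s flat_cat mem_cat xf orbT.
    have := family_uniq_flat false F1; rewrite /= -cat1s flat_cat => /uniq_apart a.
    apply: (a x) => //; rewrite -s1; apply: mem_flat; first by rewrite mem_head.
    by rewrite xs src_mem.
  (* With two segments, the first one would belong to the first family and contain [x]. *)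
  exfalso; move: nx => /negP; apply.
  have t0 : s0.1 = true.
    by case/and3P: (chc) => _ /andP[/andP[/eqP t0 _] _] _; move: t0; rewrite s1; case: (s0.1).
  have xs := so _ _ chc xv' _ ts; rewrite -t0; apply: mem_flat; first exact: mem_head.
  rewrite xs; first by apply: src_mem; apply: (chain_size chc); rewrite mem_head.
  by apply: (flat_family F1); rewrite ?mem_head.
have [ur2 sr2 ar2 Er2] := opens (rev l2) (perm_trans (permEl (perm_rev _)) p2)
  (fun e => etrans (circuit_rev _ _) (E2 e)).
pose sg := (true, rev l2).
have lk : link d s sg by rewrite /link s1 /= /src /= head_rev t2 ts.
have [chn vn] := chain_cat chc (chain_segment (s := sg) ur2 sr2) lk.
set new := rcons c' s ++ [:: sg] in chn vn.
have tg : tgt sg = z by rewrite /tgt /= last_rev h2.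
have [|||F2 E] := @family_replace [:: rcons c' s] new rest FA FB g n (rev l2)
    [:: z] F1 ur2 ar2.
- by [].
- move=> u; rewrite inE => /eqP->; rewrite (all_verts_similar _ sim).
  by rewrite -(all_verts_perm pc) (negbTE zv).
- split=> //.
  + by rewrite vn /= tg /all_verts /= cats0 perm_catC.
  + by rewrite /new !flat_cat /= cats0 flat_cons /= cats0 perm_catC.
  + by rewrite /new flat_cat /= cats0 flat_cons /= cats0.
  + split=> [e|]; last by rewrite /new /= cats0 size_cat addn1.
    by rewrite /new /= cats0 csum_cat /csum big_seq1.
have [/andP[_ _] uv _ _] := F2.1.
have uf t : uniq (flat t new).
  apply: (uniq_cat_l (T := flat t (flatten rest))); rewrite -flat_cat.
  exact: family_uniq_flat F2.
have sz : 3 < size new by rewrite size_cat addn1.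
(* The parity asked of the long chain compensates that of all the others. *)
have C := chain_cell_any (b (+) odd (size (flatten rest) + size rest)) sz chn
  (uniq_cat_l uv) uf.
have := cell_of_head F2 C; rewrite -addbA addbb addbF => -[S1 [S2 [T C']]].
by exists S1, S2, T; apply: cell_ext C' => e; rewrite Er2.
Qed.

(** The cycles of [Bs] are opened so as to cover [x] and [w] but not [z]. Those of [As] avoid [S]
    and leave [z] uncovered, and [S] comes last to set the parity; [w] supplies a positive count
    when [b] is false. *)
Lemma cycles_cell (Bs As : seq (seq V)) S i x y z r w b :
  uniq (S ++ flatten As) -> uniq (flatten Bs) ->
  2 < size S -> long_cycles As -> long_cycles Bs ->
  (forall e, circuit S e -> circuits Bs e (+) circuits As e = false) ->
  rot i S = [:: x, y, z & r] -> x \in flatten Bs -> w != z ->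
  (forall a, a \in Bs -> x \in a -> w \in a -> x = w) ->
  (~~ b -> (w \in flatten As) && (w \in flatten Bs)) ->
  exists S1 S2 T, cell b (fun e => circuits Bs e (+) circuits As e (+) circuit S e)
    S1 S2 T.
Proof.
move=> uSA uB sS sA sB disj er xB wz xw wb.
have uS := uniq_cat_l uSA.
have pr : perm_eq [:: x, y, z & r] S by rewrite -er perm_rot.
have ur : uniq [:: x, y, z & r] by rewrite (perm_uniq pr).
have xz : x != z by move: ur; rewrite /= !inE !negb_or => /andP[/and3P[]].
have zS : z \in S by rewrite -(perm_mem pr) !inE eqxx !orbT.
have [||cs [F zn Wc sub]] := @initial_family Bs (pred2 x w) z uB sB.
- by rewrite /= !(eq_sym z) negb_or xz.
- move=> a aB u v ua va /= /orP[]/eqP eu /orP[]/eqP ev; subst => //.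
    exact: (xw a).
  by apply/esym/(xw a).
have [|cs' [n [F' sub1 sup1 [wn _]]]] :=
  family_add_cycles w F (uniq_cat_r uSA) sA; first by [].
have aS : apart S (flatten As ++ [::]) by rewrite cats0; apply: uniq_apart.
apply: (family_last_cycle F' uS sS aS er) => //.
- by apply: sub1; apply: Wc => //=; rewrite eqxx.
- apply/negP => /sup1; rewrite mem_cat (negbTE zn) orbF.
  exact: (uniq_apart uSA zS).
- move=> /wb/andP[wA wB]; apply: leq_trans wn.
  by rewrite wA (Wc w) //= eqxx orbT.
Qed.

End Families.

(** * Decomposition into two families of disjoint cycles *)

Section Involutions.
Variable T : finType.

(* The orbits of [tau \o alpha] come in pairs exchanged by both involutions;
   an arbitrary order on the orbits selects one orbit in each pair. *)
Lemma involutions_two_coloring (alpha tau : T -> T) :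
  involutive alpha -> involutive tau ->
  (forall x, alpha x != x) -> (forall x, tau x != x) ->
  exists o : T -> bool,
    (forall x, o (alpha x) = ~~ o x) /\ (forall x, o (tau x) = ~~ o x).
Proof.
move=> aK tK an tn; pose f x := tau (alpha x).
have fI : injective f by move=> x y /(inv_inj tK)/(inv_inj aK).
have sym := fconnect_sym fI.
(* An equality for [n + 2] at [x] gives one for [n] at [f x]; the descent ends at a fixpoint of
   [alpha] or of [tau]. *)
have odd_free n x : alpha x != iter n f x.
  elim/ltn_ind: n x => -[|[|n]] IH x.
  - exact: an.
  - by rewrite /= /f eq_sym tn.
  have := IH n (ltnW (ltnSn _)) (f x); apply: contraNneq => E.
  apply/eqP/fI; rewrite -iterS -iterSr -E.
  by rewrite /f aK tK.
have rE x y : (froot f x == froot f y) = fconnect f x y by rewrite root_connect.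
have rn x : froot f x != froot f (alpha x).
  rewrite rE; apply/negP => /iter_findex E.
  by have := odd_free (findex f x (alpha x)) x; rewrite E eqxx.
have rt x : froot f (tau x) = froot f (alpha x).
  by apply/eqP; rewrite rE sym -[tau x](congr1 tau (aK x)) fconnect1.
have rat x : froot f (alpha (tau x)) = froot f x.
  apply/eqP; rewrite rE.
  by have := fconnect1 f (alpha (tau x)); rewrite /f aK tK.
exists (fun x => pickle (froot f x) < pickle (froot f (alpha x))).
have flip (r s : T) : r != s -> (pickle s < pickle r) = ~~ (pickle r < pickle s).
  by move=> rs; rewrite -leqNgt ltn_neqAle (inj_eq (pcan_inj pickleK)) eq_sym rs.
split=> x; first by rewrite aK flip.
by rewrite rt rat flip.
Qed.

(** Enumerate each class and exchange positions [2i] and [2i+1]; as the size is even, the last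
    position has a partner. *)
Lemma even_classes_pairing (K : eqType) (k : T -> K) :
  (forall x, ~~ odd #|[set y | k y == k x]|) ->
  exists tau : T -> T, [/\ involutive tau, forall x, tau x != x &
    forall x, k (tau x) = k x].
Proof.
move=> ev; pose A x := enum [set y | k y == k x].
pose flip i := if odd i then i.-1 else i.+1.
pose tau x := nth x (A x) (flip (index x (A x))).
have xA x : x \in A x by rewrite mem_enum inE eqxx.
have flip_lt x : flip (index x (A x)) < size (A x).
  have := xA x; rewrite -index_mem => lt; rewrite /flip.
  case: ifP => oi; first by rewrite (leq_ltn_trans (leq_pred _)).
  rewrite ltn_neqAle lt andbT; apply: contraTneq (ev x) => E.
  by rewrite negbK cardE -/(A x) -E /= oi.
have tauA x : tau x \in A x by apply: mem_nth.
have kt x : k (tau x) = k x by have := tauA x; rewrite mem_enum inE => /eqP.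
have At x : A (tau x) = A x by rewrite /A kt.
have it x : index (tau x) (A x) = flip (index x (A x)).
  by rewrite index_uniq // enum_uniq.
have flipn i : flip i != i.
  by rewrite /flip; case: i => // i; case: ifP => _ /=; rewrite ?neq_ltn ?ltnSn ?orbT.
have flipK : involutive flip.
  rewrite /flip; case=> // i /=; case oi: (odd i) => /=.
    by rewrite oi.
  by rewrite oi.
exists tau; split=> // x.
- by rewrite {1}/tau At it flipK nth_index.
- by apply: contraNneq (flipn (index x (A x))) => E; rewrite -it E.
Qed.
End Involutions.

(** * Circuits of vertex-disjoint cycles *)

Section Circuits.
Variable V : finType.
Implicit Types (S T : seq V) (Ls : seq (seq V)) (e : {set V}).

Lemma circuit_nonempty S e : circuit S e -> exists x, x \in e.
Proof.
case: S => // x S; rewrite (circuitE x) //.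
have ee u v : edge e u v -> exists y, y \in e.
  by move/eqP->; exists u; rewrite !inE eqxx.
have [/ee//|_] := boolP (edge e _ _); rewrite addbF.
elim: S x => // y S IH x; rewrite walk_cons2.
by have [/ee//|_ /IH] := boolP (edge e x y).
Qed.

Lemma circuit_apart S T e : apart S T -> circuit S e -> circuit T e -> False.
Proof.
move=> a cS cT; have [x xe] := circuit_nonempty cS.
exact: a (circuit_mem cS xe) (circuit_mem cT xe).
Qed.

Lemma circuits_cons S Ls e :
  circuits (S :: Ls) e = circuit S e (+) circuits Ls e.
Proof. by rewrite /circuits big_cons. Qed.

Lemma circuits_cat Ls Ls' e :
  circuits (Ls ++ Ls') e = circuits Ls e (+) circuits Ls' e.
Proof. by rewrite /circuits big_cat. Qed.

Lemma circuits_perm Ls Ls' e : perm_eq Ls Ls' -> circuits Ls e = circuits Ls' e.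
Proof. exact: perm_big. Qed.

(** At most one of several disjoint cycles contains [e], so the sum modulo 2 is a disjunction. *)
Lemma circuits_has Ls e : uniq (flatten Ls) ->
  circuits Ls e = has (fun S => circuit S e) Ls.
Proof.
elim: Ls => [|S Ls IH] /= uL; first by rewrite /circuits big_nil.
rewrite circuits_cons (IH (uniq_cat_r uL)).
have [cS|//] := boolP (circuit S e); apply/negP => /hasP[T TL cT].
apply: (circuit_apart _ cS cT) => x xS xT; apply: (uniq_apart uL xS).
by apply/flattenP; exists T.
Qed.
End Circuits.

(** * The nontrivial orbits of a permutation as cycles *)

Section Orbits.
Variables (V : finType) (f : V -> V).
Hypothesis fI : injective f.

(** Fixed points stand for the vertices that the family does not visit, so their orbits are left
    out. *)
Definition orbits := [seq orbit f x | x <- enum [pred x | froots f x & f x != x]].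

Lemma orbit_fixed x y : f x = x -> y \in orbit f x -> y = x.
Proof.
by move=> fx; rewrite -fconnect_orbit => /iter_findex <-; elim: (findex _ _ _) => //= n ->.
Qed.

Lemma mem_orbits x : (x \in flatten orbits) = (f x != x).
Proof.
apply/flattenP/idP => [[S /mapP[r]]|fx].
  rewrite mem_enum inE => /andP[_ fr] -> xr.
  apply: contraNneq fr => fx; apply/eqP.
  suff -> : r = x by [].
  by apply: orbit_fixed => //; rewrite -fconnect_orbit fconnect_sym // fconnect_orbit.
have xr : x \in orbit f (froot f x).
  by rewrite -fconnect_orbit fconnect_sym // connect_root.
exists (orbit f (froot f x)) => //; apply: map_f.
rewrite mem_enum inE roots_root; last exact: fconnect_sym.
apply: contraNneq fx => fr.
by rewrite (orbit_fixed fr xr) fr.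
Qed.

Lemma uniq_orbits : uniq (flatten orbits).
Proof.
rewrite /orbits; have: all (froots f) (enum [pred x | froots f x & f x != x]).
  by apply/allP => x; rewrite mem_enum inE => /andP[].
elim: (enum _) (enum_uniq [pred x | froots f x & f x != x]) => //= x L IH.
case/andP=> xL uL /andP[rx rL]; rewrite cat_uniq orbit_uniq IH // andbT /=.
apply/hasPn => y /flattenP[S /mapP[x' x'L ->]] yx'; apply: contra xL => yx.
have -> // : x = x'.
rewrite -(eqP rx) -(eqP (allP rL _ x'L)); apply/eqP.
rewrite root_connect; last exact: fconnect_sym.
rewrite -fconnect_orbit in yx; rewrite -fconnect_orbit in yx'.
by apply: connect_trans yx _; rewrite fconnect_sym.
Qed.

Lemma big_orbits : (forall x, f x != x -> f (f x) != x) -> long_cycles orbits.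
Proof.
move=> f2; apply/allP => S /mapP[x]; rewrite mem_enum inE => /andP[_ fx] ->.
have: uniq [:: x; f x; f (f x)].
  by rewrite /= !inE negb_or eq_sym fx (eq_sym x) f2 // eq_sym (inj_eq fI) fx.
move/uniq_leq_size; apply=> y; rewrite !inE => /or3P[]/eqP->.
- exact: in_orbit.
- by rewrite mem_orbit ?in_orbit.
- exact/mem_orbit/mem_orbit/in_orbit.
Qed.

Lemma circuits_orbits e : (forall x, f x != x -> f (f x) != x) ->
  reflect (exists2 x, f x != x & e = [set x; f x]) (circuits orbits e).
Proof.
move=> f2; rewrite circuits_has ?uniq_orbits //.
have orbitsE S x : S \in orbits -> x \in S -> next S x = f x.
  case/mapP=> r _ -> xr; apply/esym/eqP.
  exact: (next_cycle (cycle_orbit fI r) xr).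
have circE S : S \in orbits -> circuit S e = (e \in cycle_edges S).
  move=> SL; rewrite mem_cycle_edges //; last exact: (allP (big_orbits f2)).
  by case/mapP: SL => r _ ->; apply: orbit_uniq.
apply: (iffP hasP) => [[S SL]|[x fx ->]].
  rewrite circE // inE => /mapP[x xS ->]; exists x; last by rewrite (orbitsE S).
  by rewrite -mem_orbits; apply/flattenP; exists S.
move: (fx); rewrite -mem_orbits => /flattenP[S SL xS]; exists S => //.
rewrite -mem_cycle_edges; last exact: (allP (big_orbits f2)).
  by rewrite inE; apply/mapP; exists x; rewrite ?(orbitsE S).
by case/mapP: SL => r _ ->; apply: orbit_uniq.
Qed.

End Orbits.

(** * Oriented edges and their colouring *)

Section Decomposition.
Variables (V : finType) (G : graph V).
Hypothesis G_simple : simple G.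

Definition dart := {p : V * V | [set p.1; p.2] \in G}.
Implicit Types d : dart.

Definition source d := (val d).1.
Definition target d := (val d).2.

Lemma dart_edge d : [set source d; target d] \in G.
Proof. exact: (valP d). Qed.

Lemma dart_loopless d : source d != target d.
Proof.
by apply/eqP => E; have := G_simple (dart_edge d); rewrite E setUid cards1.
Qed.

Definition reverse d : dart :=
  exist _ (target d, source d) (etrans (congr1 (fun e => e \in G) (setUC _ _)) (dart_edge d)).

Lemma reverseK : involutive reverse.
Proof. by move=> d; apply: val_inj; case: d => -[]. Qed.

Lemma reverse_neq d : reverse d != d.
Proof.
apply: contraNneq (dart_loopless d) => E.
by have := congr1 source E; rewrite /source /= => ->.
Qed.

Lemma set2_eq (a b u v : V) : [set a; b] = [set u; v] ->
  (a = u /\ b = v) \/ (a = v /\ b = u).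
Proof. by move=> E; apply: (@edgeP _ [set a; b]); rewrite /edge ?E. Qed.

Lemma dart_of_edge d d' :
  [set source d; target d] = [set source d'; target d'] -> d = d' \/ d = reverse d'.
Proof.
case/set2_eq => -[E1 E2]; [left|right]; apply: val_inj;
  by rewrite [LHS]surjective_pairing [RHS]surjective_pairing; congr (_, _).
Qed.

Lemma degE v : deg G v = #|[set d | source d == v]|.
Proof.
rewrite /deg -(card_in_imset (f := fun d => [set source d; target d])).
  apply: eq_card => e; rewrite !inE; apply/andP/imsetP => [[eG ve]|[d]].
    have /eqP/cards2P[a [b [ab ee]]] := G_simple eG.
    have [b' eb] : exists b', e = [set v; b'].
      by move: ve; rewrite ee !inE => /orP[]/eqP->; [exists b|exists a; rewrite setUC].
    have bG : [set (v, b').1; (v, b').2] \in G by rewrite /= -eb.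
    by exists (exist _ (v, b') bG); rewrite ?inE.
  by rewrite inE => /eqP <- ->; rewrite dart_edge !inE eqxx.
move=> d d'; rewrite !inE => /eqP dv /eqP dv' /dart_of_edge[//|E].
by case/eqP: (dart_loopless d'); rewrite dv' -dv E.
Qed.

Hypothesis G_eulerian : eulerian G.
Hypothesis G_maxdeg : maxdeg G <= 4.

Lemma deg_le4 v : deg G v <= 4.
Proof. by apply: leq_trans G_maxdeg; apply: leq_bigmax. Qed.

(* An Eulerian orientation [o], together with a colouring [c] of the edges for
   which every vertex has at most one outgoing and at most one incoming edge of
   each colour, and as many of one sort as of the other. *)
Lemma oriented_coloring : exists o c : dart -> bool,
  [/\ forall d, o (reverse d) = ~~ o d,
      forall d, c (reverse d) = c d,
      forall d d', source d = source d' -> o d = o d' -> c d = c d' -> d = d',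
      forall d, exists d', [/\ source d' = source d, o d' = ~~ o d & c d' = c d] &
      forall v t, deg G v = 4 -> exists d, [/\ source d = v, o d & c d = t]].
Proof.
have [|tau [tauK taun taus]] := @even_classes_pairing _ _ source.
  by move=> d; rewrite -degE.
have [o [orev otau]] := involutions_two_coloring reverseK tauK reverse_neq taun.
pose outs p v := [set d | (source d == v) && (o d == p)].
(* [tau] exchanges the outgoing and incoming darts at [v], so the orientation is balanced. *)
have outsC p v : #|outs p v| = #|outs (~~ p) v|.
  rewrite -(card_imset _ (inv_inj tauK)); apply: eq_card => d.
  apply/imsetP/idP => [[d']|].
    rewrite !inE => /andP[/eqP<- /eqP<-] ->.
    by rewrite taus otau !eqxx.
  rewrite !inE => /andP[/eqP<- /eqP op]; exists (tau d); last by rewrite tauK.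
  by rewrite inE taus otau op negbK !eqxx.
have deg_outs p v : deg G v = #|outs p v|.*2.
  rewrite degE -addnn {2}outsC -(cardsID [set d | o d == p]).
  congr (_ + _); apply: eq_card => d; rewrite !inE //.
  by rewrite andbC; case: (o d); case: p.
(* At a vertex of degree 4 the two outgoing darts are paired, and the two incoming ones; elsewhere
   the class consists of all darts at the vertex. *)
pose k d := (source d, o d && (deg G (source d) == 4)).
have class4 d : deg G (source d) = 4 -> [set d' | k d' == k d] = outs (o d) (source d).
  move=> d4; apply/setP => d'; rewrite !inE /k xpair_eqE.
  by case: eqP => //= ->; rewrite d4 eqxx !andbT.
have class2 d : deg G (source d) != 4 ->
    [set d' | k d' == k d] = [set d' | source d' == source d].
  move=> d4; apply/setP => d'; rewrite !inE /k xpair_eqE.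
  by case: eqP => //= ->; rewrite (negbTE d4) !andbF eqxx.
have [|sig [sigK sign sigk]] := @even_classes_pairing _ _ k.
  move=> d; have [d4|d4] := eqVneq (deg G (source d)) 4; last first.
    by rewrite class2 // -degE.
  rewrite class4 //; have := deg_outs (o d) (source d); rewrite d4.
  by case: #|_| => [|[|[|]]].
have [b [brev bsig]] := involutions_two_coloring reverseK sigK reverse_neq sign.
have sigs d : source (sig d) = source d by have [] := sigk d.
have sigo d : deg G (source d) = 4 -> o (sig d) = o d.
  by move=> d4; have [_] := sigk d; rewrite sigs d4 eqxx !andbT.
have two (A : {set dart}) d d1 d2 : #|A| <= 2 -> d \in A -> d1 \in A -> d2 \in A ->
    d1 != d -> d2 != d -> d1 = d2.
  move=> A2 dA d1A d2A n1 n2; apply/eqP/negPn/negP => n12.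
  have: uniq [:: d; d1; d2] by rewrite /= !inE negb_or eq_sym n1 eq_sym n2 n12.
  move/card_uniqP => /= E; have: #|[:: d; d1; d2]| <= #|A|.
    by apply/subset_leq_card/subsetP => x; rewrite !inE => /or3P[]/eqP->.
  by rewrite E => /leq_trans/(_ A2).
have sig2 d : deg G (source d) != 4 -> sig d = tau d.
  move=> d4; have d2 : #|[set d' | source d' == source d]| <= 2.
    have := deg_le4 (source d); rewrite -degE leq_eqVlt (negbTE d4) /= ltnS.
    by rewrite leq_eqVlt => /orP[/eqP E|//]; have := G_eulerian (source d); rewrite E.
  by apply: (two _ d _ _ d2); rewrite ?inE ?sigs ?taus ?eqxx.
(* Reversal flips both terms, so the sum colours edges. At degree 4 [sig] flips only [b], separating
   darts of equal direction; elsewhere it is [tau] and preserves the colour. *)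
exists o, (fun d => b d (+) o d); split.
- exact: orev.
- by move=> d; rewrite brev orev addbN addNb negbK.
- move=> d d' sd od cd; apply/eqP/negPn/negP => dd'.
  have bd : b d = b d' by move: cd; rewrite od => /addIb.
  have d4 : deg G (source d) = 4.
    apply/eqP; rewrite eqn_leq deg_le4 (deg_outs (o d)) (leq_double 2).
    rewrite (cardD1 d) (cardD1 d') !inE eqxx sd eq_sym dd' od !eqxx.
    by [].
  have o2 : #|outs (o d) (source d)| <= 2.
    by rewrite -leq_double -deg_outs d4.
  have sd' : sig d = d'.
    apply: (two _ d _ _ o2); rewrite ?inE ?sigs ?sigo ?eqxx //.
      by rewrite sd od !eqxx.
    by rewrite eq_sym.
  by have := bsig d; rewrite sd' bd; case: (b d').
- move=> d; have [d4|d4] := eqVneq (deg G (source d)) 4; last first.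
    exists (tau d); rewrite taus otau; split=> //.
    by rewrite -(sig2 d d4) bsig addbN addNb negbK.
  have t4 : deg G (source (tau d)) = 4 by rewrite taus.
  (* If [tau d] has the wrong colour, its partner under [sig] has the same direction and the right
     one. *)
  have [E|E] := eqVneq (b (tau d) (+) o (tau d)) (b d (+) o d).
    by exists (tau d); split; [exact: taus|exact: otau|exact: E].
  exists (sig (tau d)); rewrite sigs sigo // taus otau; split=> //.
  by rewrite bsig; move: E; rewrite otau; case: (b _); case: (b d); case: (o d).
- move=> v t v4; have: 0 < #|outs true v|.
    by rewrite -double_gt0 -deg_outs v4.
  case/card_gt0P => d; rewrite inE => /andP[/eqP dv /eqP od].
  have d4 : deg G (source d) = 4 by rewrite dv.
  have [E|E] := eqVneq (b d (+) o d) t; first by exists d.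
  exists (sig d); rewrite sigs sigo // bsig; split=> //.
  by move: E; rewrite od; case: (b d); case: (t).
Qed.

(** Following the outgoing dart of one colour, where it exists, is a permutation; its nontrivial
    orbits form the family of that colour. *)
Lemma two_families_of_cycles : exists As Bs : seq (seq V),
  [/\ uniq (flatten As), uniq (flatten Bs), long_cycles As & long_cycles Bs] /\
  [/\ forall e, (e \in G) = circuits As e (+) circuits Bs e,
      forall e, circuits As e -> circuits Bs e -> False &
      forall v, deg G v = 4 -> v \in flatten As /\ v \in flatten Bs].
Proof.
have [o [c [orev crev inj bal all4]]] := oriented_coloring.
pose f t v := if [pick d | [&& source d == v, o d & c d == t]] is Some d
  then target d else v.
have fE d : o d -> f (c d) (source d) = target d.
  move=> od; rewrite /f; case: pickP => [d'|/(_ d)]; last by rewrite od !eqxx.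
  by case/and3P=> /eqP sd od' /eqP cd; rewrite (inj d' d) // od.
have fN t v : f t v != v -> exists d, [/\ source d = v, o d, c d = t & f t v = target d].
  rewrite /f; case: pickP => [d /and3P[/eqP sd od /eqP cd] _|]; last by rewrite eqxx.
  by exists d.
(* A vertex has at most one incoming dart of each colour, and a vertex with one also has an outgoing
   one, hence is not fixed. *)
have fI t : injective (f t).
  have aux u v : f t u = f t v -> f t u != u -> u = v.
    move=> E /fN[d [sd od cd Ed]].
    have [Ev|/fN[d' [sd' od' cd' Ed']]] := eqVneq (f t v) v; last first.
      have : reverse d = reverse d'.
        by apply: inj; rewrite ?orev ?crev ?od ?od' ?cd ?cd' // /source /= -Ed -Ed'.
      by move/(inv_inj reverseK) => dd'; rewrite -sd -sd' dd'.
    have [d' [sd' od' cd']] := bal (reverse d).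
    rewrite orev od in od'; rewrite crev cd in cd'.
    have sv : source d' = v by rewrite sd' /source /= -Ed E.
    have := fE d' od'; rewrite cd' sv Ev => tv.
    by case/eqP: (dart_loopless d'); rewrite sv -tv.
  move=> u v E; have [Eu|] := eqVneq (f t u) u; last exact: aux.
  have [Ev|nv] := eqVneq (f t v) v; first by rewrite -Eu E.
  exact/esym/(aux v u).
(* An orbit of length 2 would follow a dart and its reverse, both outgoing. *)
have f2 t x : f t x != x -> f t (f t x) != x.
  move=> nx; have [d [sd od cd Ed]] := fN _ _ nx.
  apply/negP => /eqP E; have [|d' [sd' od' cd' Ed']] := fN t (f t x).
    by rewrite E eq_sym.
  have dd' : d' = reverse d.
    apply: val_inj; rewrite [LHS]surjective_pairing -/(source d') -/(target d').
    by rewrite sd' -Ed' E Ed -sd.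
  by have := orev d; rewrite -dd' od od'.
have edgeE t e : reflect (exists d, [/\ o d, c d = t & e = [set source d; target d]])
    (circuits (orbits (f t)) e).
  apply: (iffP (circuits_orbits (fI t) e (f2 t))) => [[x nx ->]|[d [od <- ->]]].
    by have [d [sd od cd Ed]] := fN _ _ nx; exists d; rewrite sd Ed.
  exists (source d); rewrite fE //.
  by rewrite eq_sym dart_loopless.
exists (orbits (f true)), (orbits (f false)).
have excl e : circuits (orbits (f true)) e -> circuits (orbits (f false)) e -> False.
  case/edgeE=> d [od cd ->] /edgeE[d' [od' cd' /dart_of_edge[]]] E.
    by move: cd cd'; rewrite E => ->.
  by move: cd cd'; rewrite E crev => ->.
split; first by split; [exact: uniq_orbits|exact: uniq_orbits|
  exact: big_orbits (f2 _)|exact: big_orbits (f2 _)].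
split=> // [e|v v4]; last first.
  rewrite !mem_orbits //.
  by split; [have [d [sd od cd]] := all4 v true v4|have [d [sd od cd]] := all4 v false v4];
    rewrite -sd -cd fE // eq_sym dart_loopless.
apply/idP/idP => [eG|].
  have [x [y exy]] : exists x y, e = [set x; y].
    by have /eqP/cards2P[x [y [_ ->]]] := G_simple eG; exists x, y.
  have eG' : [set (x, y).1; (x, y).2] \in G by rewrite /= -exy.
  have [d od ed] : exists2 d, o d & e = [set source d; target d].
    pose d0 : dart := exist _ (x, y) eG'; have [od|od] := boolP (o d0).
      by exists d0.
    by exists (reverse d0); rewrite ?orev // setUC.
  have := excl e; case cd: (c d).
    have -> : circuits (orbits (f true)) e by apply/edgeE; exists d.
    by case: (circuits _ e) => // /(_ isT isT).
  have -> : circuits (orbits (f false)) e by apply/edgeE; exists d.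
  by case: (circuits _ e) => // /(_ isT isT).
have inG t : circuits (orbits (f t)) e -> e \in G.
  by case/edgeE=> d [_ _ ->]; apply: dart_edge.
by case: (boolP (circuits (orbits (f true)) e)) => [/inG//|_ /inG].
Qed.

End Decomposition.

(** * The odd covers *)

Section Assembly.
Variable V : finType.
Implicit Types (S T : seq V) (Ls : seq (seq V)) (e : {set V}).

(** [P] links all the opened cycles, and [R] alternates between their removed edges and the same
    links, which cancel. *)
Lemma cell_single_circuits (d : V) Ls : Ls != [::] -> uniq (flatten Ls) ->
  long_cycles Ls -> cell_single d (circuits Ls) (flatten Ls) (flatten Ls).
Proof.
have nn n S : n < size S -> S != [::] by case: S.
elim: Ls => // S Ls IH _ /= uL /andP[sS sL]; have uS := uniq_cat_l uL.
have nS := nn _ _ sS.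
have hm : head d S \in S by apply: head_mem; rewrite ltnW // ltnW.
have lm : last d S \in S by apply: last_mem; rewrite ltnW // ltnW.
have hl : head d S != last d S by apply: head_neq_last; rewrite // ltnW.
have [->|L0] := eqVneq Ls [::].
  exists S, [:: head d S; last d S]; rewrite /= cats0 andbT inE; split=> //.
  split=> // [x|e]; first by rewrite !inE => /orP[]/eqP->.
  rewrite /circuits big_seq1 (circuitE d) // walk_cons2 walk1 addbF.
  by rewrite (edgeC _ (last d S)).
have [P [R [[uP uR sP sR] [PL RL eh el E]]]] := IH L0 (uniq_cat_r uL) sL.
have [nP nR] := (nn _ _ sP, nn _ _ sR).
exists (S ++ P), ([:: head d S; last d S] ++ R).
have a := uniq_apart uL.
split; first split.
- exact: uniq_cat_apart a uS uP _ PL.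
- apply: uniq_cat_apart a _ uR _ RL; first by rewrite /= inE hl.
  by move=> x; rewrite !inE => /orP[]/eqP->.
- by rewrite size_cat ltn_addr.
- by [].
split.
- by apply: sub_cat; [apply: sub_catl|apply: sub_catr].
- apply: sub_cat; [apply: sub_catl|exact: sub_catr].
  by move=> x; rewrite !inE => /orP[]/eqP->.
- by rewrite head_cat0.
- by rewrite !last_cat0.
move=> e; rewrite circuits_cons E (circuitE d) // !(walk_cat d) //.
rewrite walk_cons2 walk1 eh (edgeC _ (last d S) (head d S)) /=.
by xor_cases.
Qed.

Lemma one_cycle_cover (G : graph V) S Ls :
  uniq S -> 2 < size S -> Ls != [::] -> uniq (flatten Ls) -> long_cycles Ls ->
  (forall e, (e \in G) = circuit S e (+) circuits Ls e) ->
  exists Hs : {set graph V}, cycle_odd_cover G Hs /\ #|Hs| <= 3.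
Proof.
case: S => // d S uS sS L0 uL sL.
exact: circuit_single_cover uS sS (cell_single_circuits d L0 uL sL).
Qed.

Lemma mem_flatten_perm Ls (x : V) : x \in flatten Ls ->
  exists S Ls', perm_eq Ls (S :: Ls') /\ x \in S.
Proof.
by case/flattenP=> S SL xS; exists S, (rem S Ls); split=> //; apply: perm_to_rem.
Qed.

Lemma cell_of_cycles (G : graph V) (As Bs As' : seq (seq V)) S x w b :
  uniq (flatten As) -> uniq (flatten Bs) -> long_cycles As -> long_cycles Bs ->
  (forall e, (e \in G) = circuits As e (+) circuits Bs e) ->
  (forall e, circuits As e -> circuits Bs e -> False) ->
  perm_eq As (S :: As') -> x \in S -> x \in flatten Bs ->
  w = x \/ w \notin S ->
  (forall a, a \in Bs -> x \in a -> w \in a -> x = w) ->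
  (~~ b -> (w \in flatten As') && (w \in flatten Bs)) ->
  exists S1 S2 T, cell x b (fun e => e \in G) S1 S2 T.
Proof.
move=> uA uB sA sB E excl pA xS xB wS xw wb.
have uSA : uniq (S ++ flatten As') by rewrite -(perm_uniq (perm_flatten pA)).
have /andP[sS sA'] : long_cycles (S :: As') by rewrite /long_cycles -(perm_all _ pA).
case/rot_to: (xS) => i r er.
have pr : perm_eq (x :: r) S by rewrite -er perm_rot.
have : 2 < size (x :: r) by rewrite (perm_size pr).
case: r er pr => [|y [|z r]] // er pr _.
have ur : uniq [:: x, y, z & r] by rewrite (perm_uniq pr) (uniq_cat_l uSA).
(* Either [w] is [x], which differs from [z], or [w] is off [S] while [z] is on it. *)
have wz : w != z.
  case: wS => [->|wS].
    by move: ur; rewrite /= !inE !negb_or => /andP[/and3P[]].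
  apply: contraNneq wS => ->.
  by rewrite -(perm_mem pr) !inE eqxx !orbT.
have AE e : circuits As e = circuit S e (+) circuits As' e.
  by rewrite (circuits_perm e pA) circuits_cons.
have disj e : circuit S e -> circuits Bs e (+) circuits As' e = false.
  move=> cS; have cA : circuits As' e = false.
    apply/negP; rewrite circuits_has ?(uniq_cat_r uSA) // => /hasP[T TA cT].
    apply: (circuit_apart _ cS cT) => u uS uT; apply: (uniq_apart uSA uS).
    by apply/flattenP; exists T.
  rewrite cA addbF; apply/negP => /excl; apply.
  by rewrite AE cS cA.
have [S1 [S2 [T C]]] :=
  cycles_cell x uSA uB sS sA' sB disj er xB wz xw wb.
exists S1, S2, T; apply: cell_ext C => e.
by rewrite E AE; case: (circuits Bs e); case: (circuits As' e); case: (circuit S e).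
Qed.

Lemma path_cover_of_cycles (G : graph V) (As Bs : seq (seq V)) x :
  uniq (flatten As) -> uniq (flatten Bs) -> long_cycles As -> long_cycles Bs ->
  (forall e, (e \in G) = circuits As e (+) circuits Bs e) ->
  (forall e, circuits As e -> circuits Bs e -> False) ->
  x \in flatten As -> x \in flatten Bs ->
  exists Hs : {set graph V}, path_odd_cover G Hs /\ #|Hs| <= 3.
Proof.
move=> uA uB sA sB E excl /mem_flatten_perm[S [As' [pA xS]]] xB.
have [|||S1 [S2 [T C]]] := @cell_of_cycles G As Bs As' S x x true
  uA uB sA sB E excl pA xS xB; rewrite //; first by left.
exact: (cell_odd_cover C).
Qed.

(** Two shared vertices on different cycles in both families give an even cell. Otherwise all shared
    vertices lie on [S] or all lie on [D], and the remaining cycles are pairwise disjoint. *)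
Lemma cycle_cover_of_cycles (G : graph V) (As Bs : seq (seq V)) x :
  uniq (flatten As) -> uniq (flatten Bs) -> long_cycles As -> long_cycles Bs ->
  (forall e, (e \in G) = circuits As e (+) circuits Bs e) ->
  (forall e, circuits As e -> circuits Bs e -> False) ->
  x \in flatten As -> x \in flatten Bs ->
  exists Hs : {set graph V}, cycle_odd_cover G Hs /\ #|Hs| <= 3.
Proof.
move=> uA uB sA sB E excl /mem_flatten_perm[S [As' [pA xS]]].
move=> /mem_flatten_perm[D [Bs' [pB xD]]].
have uSA : uniq (S ++ flatten As') by rewrite -(perm_uniq (perm_flatten pA)).
have uDB : uniq (D ++ flatten Bs') by rewrite -(perm_uniq (perm_flatten pB)).
have [aS aD] := (uniq_apart uSA, uniq_apart uDB).
have /andP[sS sA'] : long_cycles (S :: As') by rewrite /long_cycles -(perm_all _ pA).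
have /andP[sD sB'] : long_cycles (D :: Bs') by rewrite /long_cycles -(perm_all _ pB).
have memB u : (u \in flatten Bs) = (u \in D) || (u \in flatten Bs').
  by rewrite (perm_mem (perm_flatten pB)) mem_cat.
have matched u w : u \in S -> u \in flatten Bs -> w \in flatten As' ->
    w \in flatten Bs -> (forall a, a \in Bs -> u \in a -> w \in a -> u = w) ->
    exists Hs : {set graph V}, cycle_odd_cover G Hs /\ #|Hs| <= 3.
  move=> uS uBs wA wBs uw.
  have [|||S1 [S2 [T C]]] := @cell_of_cycles G As Bs As' S u w false
    uA uB sA sB E excl pA uS uBs.
  - by right; apply/negP => /aS; apply.
  - exact: uw.
  - by rewrite wA wBs.
  exact: (cell_even_cover C).
have inB a u : a \in Bs -> u \in a -> u \in D -> a = D.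
  rewrite (perm_mem pB) inE => /predU1P[//|aB'] ua uD.
  by case: (aD u uD); apply/flattenP; exists a.
(* A shared vertex off both [S] and [D] is matched with [x]. *)
have [/hasP[w wA wB']|/hasPn nAB'] :=
  boolP (has (fun w => w \in flatten Bs') (flatten As')).
  apply: (matched x w) => //; rewrite ?memB ?xD ?wB' ?orbT // => a aB xa wa.
  by case: (aD w) => //; rewrite -(inB a x aB xa xD).
have [/hasP[w wA wD]|/hasPn nAD] := boolP (has (fun w => w \in D) (flatten As')).
  (* Here [w] is on [D] but off [S]; a shared vertex on [S] but off [D] is its match. *)
  have [/hasP[u uS uB']|/hasPn nSB'] := boolP (has (fun u => u \in flatten Bs') S).
    apply: (matched u w) => //; rewrite ?memB ?wD ?uB' ?orbT // => a aB ua wa.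
    by case: (aD u) => //; rewrite -(inB a w aB wa wD).
  (* All shared vertices lie on [D], so [Bs'] and [As] form one disjoint family. *)
  have a1 : apart (flatten Bs') (flatten As).
    move=> u uB'; rewrite (perm_mem (perm_flatten pA)) mem_cat => /orP[/nSB'|/nAB'];
      by rewrite uB'.
  apply: (one_cycle_cover (S := D) (Ls := Bs' ++ As)) => //.
  - exact: uniq_cat_l uDB.
  - by case: As pA {uA sA E excl a1} => [/perm_size//|a As _]; case: (Bs').
  - rewrite flatten_cat; exact: uniq_cat_apart a1 (uniq_cat_r uDB) uA _ _.
  - by rewrite /long_cycles all_cat; apply/andP; split.
  - move=> e; rewrite E circuits_cat (circuits_perm e pB) circuits_cons.
    by case: (circuits As e); case: (circuit D e); case: (circuits Bs' e).
(* All shared vertices lie on [S]. *)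
have a1 : apart (flatten As') (flatten Bs).
  by move=> u uA'; rewrite memB => /orP[uD|uB'];
    [have := nAD u uA'; rewrite uD|have := nAB' u uA'; rewrite uB'].
apply: (one_cycle_cover (S := S) (Ls := As' ++ Bs)) => //.
- exact: uniq_cat_l uSA.
- by case: Bs pB {uB sB E excl a1 memB matched inB} => [/perm_size//|a Bs _]; case: (As').
- rewrite flatten_cat; exact: uniq_cat_apart a1 (uniq_cat_r uSA) uB _ _.
- by rewrite /long_cycles all_cat; apply/andP; split.
- move=> e; rewrite E circuits_cat (circuits_perm e pA) circuits_cons.
  by rewrite addbA.
Qed.

End Assembly.

Theorem theorem1p4 (V : finType) (G : graph V)
    (G_simple : simple G) (G_no_isolated : no_isolated G)
    (G_eulerian : eulerian G) (G_maxdeg : maxdeg G = 4) :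
  (exists Hs : {set graph V}, path_odd_cover G Hs /\ #|Hs| <= 3) /\
  (exists Hs : {set graph V}, cycle_odd_cover G Hs /\ #|Hs| <= 3).
Proof.
have le4 : maxdeg G <= 4 by rewrite G_maxdeg.
have [As [Bs [[uA uB sA sB] [E excl mem4]]]] :=
  two_families_of_cycles G_simple G_eulerian le4.
have [x x4] : exists x, deg G x = 4.
  have [x _|V0] := pickP (@predT V).
    by exists [arg max_(y > x) deg G y]; rewrite -G_maxdeg /maxdeg (bigmax_eq_arg x).
  by move: G_maxdeg; rewrite /maxdeg big_pred0.
have [xA xB] := mem4 x x4.
split; first exact: path_cover_of_cycles uA uB sA sB E excl xA xB.
exact: cycle_cover_of_cycles uA uB sA sB E excl xA xB.
Qed.
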